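(* The following linear map is a Hopf algebra automorphism: $$\theta:(\mathcal{H}_{\mathbf{qp}},m,\Delta)\to(\mathcal{H}_{\mathbf{qp}},m,\Delta),\qquad \lfloor P\rfloor\mapsto\sum_{\sim\triangleleft P}\lfloor P/\sim\rfloor.$$ Its inverse is $$\theta^{-1}:\ \lfloor P\rfloor\mapsto\sum_{\sim\triangleleft P}(-1)^{cl(\sim)+cl(P)}\lfloor P/\sim\rfloor.$$ Moreover, $ehr^{str}\circ\theta=ehr$ and $ehr\circ\theta^{-1}=ehr^{str}$.
   Context: $\mathbb{K}$ is a field of characteristic zero. A quasi-poset is a pair $P=(A,\leq_P)$ with $A$ finite and $\leq_P$ reflexive and transitive; $x\sim_Py$ means $x\leq_Py$ and $y\leq_Px$; $cl(P)$ is the number of $\sim_P$-classes; $\lfloor P\rfloor$ is the isoclass; $P_{\mid B}$ is the restriction to $B\subseteq A$; $top(P)$ is the topology of open sets, i.e. subsets $O$ with ($i\in O$, $i\leq_Pj$)$\Rightarrow j\in O$; $P$ is connected if this topology is connected. For an equivalence $\sim$ on $A$, $cl(\sim)$ is its number of classes, and $P/\sim$ is the quasi-poset on $A$ whose quasi-order $\leq_{P/\sim}$ is the transitive closure of the relation ($x\leq_Py$ or $x\sim y$). We write $\sim\triangleleft P$ if the restriction of $P$ to each class of $\sim$ is connected and $\sim_{P/\sim}$ equals $\sim$. $\mathcal{H}_{\mathbf{qp}}$ is the $\mathbb{K}$-vector space with basis the set of isoclasses of quasi-posets; its product $m$ is disjoint union (unit: the empty quasi-poset) and its coproduct is $\Delta(\lfloor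 P\rfloor)=\sum_{O\in top(P)}\lfloor P_{\mid A\setminus O}\rfloor\otimes\lfloor P_{\mid O}\rfloor$; it is a Hopf algebra. For $k\ge1$, $L_P(k)$ is the set of maps $f:A\to\{1,\ldots,k\}$ with $i\leq_Pj\Rightarrow f(i)\leq f(j)$, and $L^{str}_P(k)$ the set of $f\in L_P(k)$ such that ($i\leq_Pj$ and $f(i)=f(j)$)$\Rightarrow i\sim_Pj$. $ehr_P$, $ehr_P^{str}$ are the unique polynomials with $ehr_P(k)=\sharp L_P(k)$, $ehr_P^{str}(k)=\sharp L_P^{str}(k)$ for all $k\geq1$; $ehr,ehr^{str}:\mathcal{H}_{\mathbf{qp}}\to\mathbb{K}[X]$ are the linear maps sending $\lfloor P\rfloor$ to $ehr_P$, $ehr_P^{str}$. *)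

(* Defs.v *)
From HB Require Import structures.
From Stdlib Require Import ClassicalEpsilon.
From mathcomp Require Import all_boot all_order all_algebra finmap.
From mathcomp Require Import generic_quotient.
From mathcomp Require Import monalg.

Set Implicit Arguments.
Unset Strict Implicit.
Unset Printing Implicit Defensive.

Import GRing.Theory.
Local Open Scope ring_scope.
Local Open Scope quotient_scope.

Definition quasi_order (A : finType) (r : {set A * A}) : bool :=
  [forall x, (x, x) \in r] &&
  [forall x, forall y, forall z,
     ((x, y) \in r) && ((y, z) \in r) ==> ((x, z) \in r)].

Record qposet (A : finType) := QPoset {
  qp_graph : {set A * A};
  qp_graphP : quasi_order qp_graph }.

HB.instance Definition _ (A : finType) := [isSub for @qp_graph A].
HB.instance Definition _ (A : finType) := [Finite of qposet A by <:].

Definition qle (A : finType) (P : qposet A) : rel A :=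
  fun x y => (x, y) \in qp_graph P.

Lemma qle_refl A (P : qposet A) : reflexive (qle P).
Proof. by move=> x; case/andP: (qp_graphP P) => /forallP/(_ x). Qed.

Lemma qle_trans A (P : qposet A) : transitive (qle P).
Proof.
move=> y x z xy yz; case/andP: (qp_graphP P) => _.
move=> /forallP/(_ x)/forallP/(_ y)/forallP/(_ z)/implyP; apply.
exact/andP.
Qed.

Lemma rel_quasi_order (A : finType) (r : rel A) :
  reflexive r -> transitive r -> quasi_order [set u | r u.1 u.2].
Proof.
move=> rr rt; apply/andP; split; first by apply/forallP => x; rewrite inE.
do 3!apply/forallP => ?; apply/implyP; rewrite !inE /= => /andP[].
exact: rt.
Qed.

Definition qposet_of (A : finType) (r : rel A)
    (rr : reflexive r) (rt : transitive r) : qposet A :=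
  QPoset (rel_quasi_order rr rt).

Lemma qposet_ofE (A : finType) (r : rel A) (rr : reflexive r) (rt : transitive r) :
  qle (qposet_of rr rt) =2 r.
Proof. by move=> x y; rewrite /qle inE. Qed.

Lemma qposetP A (P Q : qposet A) : qle P =2 qle Q -> P = Q.
Proof. by move=> e; apply/val_inj/setP => -[x y]; apply: e. Qed.

Definition qsim (A : finType) (P : qposet A) : rel A :=
  fun x y => qle P x y && qle P y x.

Definition ncl (A : finType) (e : rel A) : nat :=
  #|equivalence_partition e [set: A]|.

Definition qpull (A B : finType) (f : A -> B) (P : qposet B) : qposet A :=
  @qposet_of A (fun x y => qle P (f x) (f y))
    (fun x => qle_refl P (f x)) (fun y x z => @qle_trans B P (f y) (f x) (f z)).

Definition qrestr (A : finType) (P : qposet A) (B : {set A}) :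
    qposet {x : A | x \in B} :=
  qpull val P.

Definition qopen (A : finType) (P : qposet A) (O : {set A}) : bool :=
  [forall x, forall y, (x \in O) && qle P x y ==> (y \in O)].

Definition qconnected (A : finType) (P : qposet A) : bool :=
  [forall O : {set A},
     qopen P O && qopen P (~: O) ==> (O == set0) || (O == [set: A])].

Definition equiv_graph (A : finType) (r : {set A * A}) : bool :=
  quasi_order r && [forall x, forall y, ((x, y) \in r) ==> ((y, x) \in r)].

Record eqv (A : finType) := Eqv {
  eqv_graph : {set A * A};
  eqv_graphP : equiv_graph eqv_graph }.

HB.instance Definition _ (A : finType) := [isSub for @eqv_graph A].
HB.instance Definition _ (A : finType) := [Finite of eqv A by <:].

Definition eqv_rel (A : finType) (E : eqv A) : rel A :=
  fun x y => (x, y) \in eqv_graph E.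

(* [connect] is the reflexive transitive closure; since [qle P] is reflexive  *)
(* it is here the transitive closure.                                         *)
Definition qquot (A : finType) (P : qposet A) (E : eqv A) : qposet A :=
  let r := [rel x y | qle P x y || eqv_rel E x y] in
  qposet_of (@connect0 A r) (@connect_trans A r).

Definition qcompat (A : finType) (E : eqv A) (P : qposet A) : bool :=
  [forall B in equivalence_partition (eqv_rel E) [set: A],
     qconnected (qrestr P B)] &&
  [forall x, forall y, qsim (qquot P E) x y == eqv_rel E x y].

Definition sum_rel (A B : finType) (P : qposet A) (Q : qposet B) :
    rel (A + B)%type :=
  fun u v => match u, v with
             | inl x, inl y => qle P x y
             | inr x, inr y => qle Q x y
             | _, _ => false
             end.

Lemma sum_rel_refl A B (P : qposet A) (Q : qposet B) : reflexive (sum_rel P Q).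
Proof. by case=> x; apply: qle_refl. Qed.

Lemma sum_rel_trans A B (P : qposet A) (Q : qposet B) : transitive (sum_rel P Q).
Proof. by move=> [y|y] [x|x] [z|z] //=; apply: qle_trans. Qed.

Definition qsum (A B : finType) (P : qposet A) (Q : qposet B) :
    qposet (A + B)%type :=
  qposet_of (@sum_rel_refl A B P Q) (@sum_rel_trans A B P Q).

Definition qvoid : qposet void :=
  @qposet_of void (fun _ _ => true) (fun _ => isT) (fun _ _ _ _ _ => isT).

Definition isomorphic (A B : finType) (P : qposet A) (Q : qposet B) : Prop :=
  exists2 f : A -> B, bijective f & forall x y, qle P x y = qle Q (f x) (f y).

Definition isob (A B : finType) (P : qposet A) (Q : qposet B) : bool :=
  [exists f : {ffun A -> B}, [&& injectiveb f, #|B| <= #|A| &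
     [forall x, forall y, qle P x y == qle Q (f x) (f y)]]]%N.

Lemma isoP A B (P : qposet A) (Q : qposet B) :
  reflect (isomorphic P Q) (isob P Q).
Proof.
apply: (iffP existsP) => [[f /and3P[/injectiveP fi le /forallP h]]|[f fb h]].
  exists f; first exact: inj_card_bij.
  by move=> x y; move/forallP: (h x) => /(_ y)/eqP.
exists (finfun f); apply/and3P; split.
- by apply/injectiveP => x y; rewrite !ffunE; apply: bij_inj.
- by rewrite (bij_eq_card fb).
- by apply/forallP => x; apply/forallP => y; rewrite !ffunE h.
Qed.

Lemma iso_refl A (P : qposet A) : isomorphic P P.
Proof. by exists id => //; exists id. Qed.

Lemma iso_sym A B (P : qposet A) (Q : qposet B) :
  isomorphic P Q -> isomorphic Q P.
Proof.
case=> f [g fK gK] h; exists g; first by exists f.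
by move=> x y; rewrite h !gK.
Qed.

Lemma iso_trans A B C (P : qposet A) (Q : qposet B) (R : qposet C) :
  isomorphic P Q -> isomorphic Q R -> isomorphic P R.
Proof.
case=> f fb hf [g gb hg]; exists (g \o f); first exact: bij_comp.
by move=> x y; rewrite hf hg.
Qed.

(* Every finite quasi-poset is isomorphic to one carried by some 'I_n, so     *)
(* isoclasses form the quotient of the following type.                        *)
Definition qpcode := {n : nat & qposet 'I_n}.
HB.instance Definition _ := Choice.on qpcode.

Definition code_iso : rel qpcode := fun c d => isob (tagged c) (tagged d).

Lemma code_iso_refl : reflexive code_iso.
Proof. by move=> c; apply/isoP/iso_refl. Qed.

Lemma code_iso_sym : symmetric code_iso.
Proof. by move=> c d; apply/isoP/isoP => /iso_sym. Qed.

Lemma code_iso_trans : transitive code_iso.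
Proof. by move=> d c e /isoP cd /isoP /(iso_trans cd) h; apply/isoP. Qed.

Canonical code_iso_equiv : equiv_rel qpcode :=
  EquivRel code_iso code_iso_refl code_iso_sym code_iso_trans.

Definition isoclass := {eq_quot code_iso}%qT.
HB.instance Definition _ := Choice.on isoclass.
HB.instance Definition _ := EqQuotient.on isoclass.

Definition qpcode_of (A : finType) (P : qposet A) : qpcode :=
  Tagged (fun n => qposet 'I_n) (qpull (@enum_val A A) P).

(* Locked, so that conversion never unfolds the quotient.                     *)
HB.lock Definition icl (A : finType) (P : qposet A) : isoclass :=
  \pi_isoclass (qpcode_of P).

Definition irep (c : isoclass) : qposet 'I_(tag (repr c)) := tagged (repr c).

Lemma iso_code A (P : qposet A) : isomorphic (tagged (qpcode_of P)) P.
Proof.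
exists (@enum_val A A); first exact: enum_val_bij.
by move=> x y; rewrite qposet_ofE.
Qed.

Lemma iclP A B (P : qposet A) (Q : qposet B) :
  icl P = icl Q <-> isomorphic P Q.
Proof.
rewrite icl.unlock; split=> [/eqmodP/isoP h|h].
  exact: iso_trans (iso_trans (iso_sym (iso_code P)) h) (iso_code Q).
apply/eqmodP/isoP.
exact: iso_trans (iso_code P) (iso_trans h (iso_sym (iso_code Q))).
Qed.

Lemma icl_irep (c : isoclass) : icl (irep c) = c.
Proof. by rewrite -[RHS]reprK icl.unlock; apply/eqmodP/isoP/iso_code. Qed.

Lemma irep_icl A (P : qposet A) : isomorphic (irep (icl P)) P.
Proof. by apply/iclP/icl_irep. Qed.

Definition iempty : isoclass := icl qvoid.

Definition imul (c d : isoclass) : isoclass := icl (qsum (irep c) (irep d)).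

Lemma iso_sum A B A' B' (P : qposet A) (Q : qposet B)
    (P' : qposet A') (Q' : qposet B') :
  isomorphic P P' -> isomorphic Q Q' -> isomorphic (qsum P Q) (qsum P' Q').
Proof.
case=> f [f' fK f'K] hf [g [g' gK g'K] hg].
exists (fun u => match u with inl x => inl (f x) | inr y => inr (g y) end).
  exists (fun u => match u with inl x => inl (f' x) | inr y => inr (g' y) end);
  by case=> x; rewrite ?fK ?f'K ?gK ?g'K.
by case=> x [] y; rewrite !qposet_ofE //=.
Qed.

Lemma imulE A B (P : qposet A) (Q : qposet B) :
  imul (icl P) (icl Q) = icl (qsum P Q).
Proof. by apply/iclP/iso_sum; apply: irep_icl. Qed.

Lemma imulA : associative imul.
Proof.
move=> c d e; rewrite -(icl_irep c) -(icl_irep d) -(icl_irep e) !imulE.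
apply/iclP.
exists (fun u => match u with
  | inl x => inl (inl x) | inr (inl x) => inl (inr x) | inr (inr x) => inr x end).
  exists (fun u => match u with
    | inl (inl x) => inl x | inl (inr x) => inr (inl x) | inr x => inr (inr x)
    end).
    by case=> [x|[x|x]].
  by case=> [[x|x]|x].
by case=> [x|[x|x]] [y|[y|y]]; rewrite !qposet_ofE //= !qposet_ofE.
Qed.

Lemma imulC : commutative imul.
Proof.
move=> c d; apply/iclP.
exists (fun u => match u with inl x => inr x | inr x => inl x end).
  by exists (fun u => match u with inl x => inr x | inr x => inl x end); case.
by case=> x [] y; rewrite !qposet_ofE.
Qed.

Lemma imul1m : left_id iempty imul.
Proof.
move=> c; rewrite -(icl_irep c) imulE; apply/iclP.
exists (fun u : (void + 'I_(tag (repr c)))%type =>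
  match u with inl v => match v with end | inr x => x end).
  by exists inr; [case=> [[]|] | ].
by case=> [[]|x] [[]|y]; rewrite !qposet_ofE.
Qed.

Lemma imulm1 : right_id iempty imul.
Proof. by move=> c; rewrite imulC imul1m. Qed.

Lemma iempty_card A (P : qposet A) : icl P = iempty -> #|A| = 0%N.
Proof. by case/iclP => f fb _; rewrite (bij_eq_card fb) card_void. Qed.

Lemma card_iempty A (P : qposet A) : #|A| = 0%N -> icl P = iempty.
Proof.
move=> A0; have e (x : A) : False by have := fintype0 x A0.
apply/iclP; exists (fun x => match e x with end); last by move=> x; case: (e x).
by exists (fun v : void => match v with end) => [x|[]]; case: (e x).
Qed.

Lemma imul_unit (c d : isoclass) :
  imul c d = iempty -> c = iempty /\ d = iempty.
Proof.
move/iempty_card/eqP; rewrite card_sum addn_eq0 => /andP[/eqP c0 /eqP d0].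
by rewrite -(icl_irep c) -(icl_irep d) !card_iempty.
Qed.

HB.instance Definition _ := Choice_isMonomialDef.Build isoclass
  imulA imul1m imulm1 imul_unit.
HB.instance Definition _ := MonomialDef_isConomialDef.Build isoclass imulC.

(* H_qp: the monoid algebra of isoclasses under disjoint union.               *)
Notation Hqp K := {malg K[isoclass]}.

(* H_qp (x) H_qp, with basis the pairs of basis elements.                     *)
Notation Hqp2 K := {malg K[(isoclass * isoclass)%type]}.

Section LinearExtension.
Variables (K : fieldType) (T : choiceType) (V : lmodType K) (F : T -> V).

Definition linext (h : {malg K[T]}) : V := \sum_(t <- msupp h) h@_t *: F t.

Lemma linextEw (d : {fset T}) h : (msupp h `<=` d)%fset ->
  linext h = \sum_(t <- d) h@_t *: F t.
Proof.
move=> le; rewrite /linext (big_fset_incl _ le) // => t _ /mcoeff_outdom ->.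
by rewrite scale0r.
Qed.

Lemma linext_is_linear : linear linext.
Proof.
move=> a g h; pose d := (msupp g `|` msupp h)%fset.
rewrite (@linextEw d g) ?fsubsetUl // (@linextEw d h) ?fsubsetUr //.
rewrite (@linextEw d); last first.
  apply/(fsubset_trans (msuppD_le _ _))/fsetSU/msuppZ_le.
rewrite scaler_sumr -big_split /=; apply: eq_bigr => t _.
by rewrite mcoeffD mcoeffZ scalerDl scalerA.
Qed.

HB.instance Definition _ :=
  GRing.isLinear.Build K {malg K[T]} V *:%R linext linext_is_linear.

Lemma linextU t : linext << t >> = F t.
Proof.
rewrite (@linextEw [fset t]%fset) ?msuppU_le //.
by rewrite big_seq_fset1 mcoeffUU scale1r.
Qed.

End LinearExtension.

Section HopfStructure.
Variable K : fieldType.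

Definition tens (u v : Hqp K) : Hqp2 K :=
  \sum_(c <- msupp u) \sum_(d <- msupp v) << u@_c * v@_d *g (c, d) >>.

Definition tensmap (f g : Hqp K -> Hqp K) : Hqp2 K -> Hqp2 K :=
  linext (fun cd => tens (f << cd.1 >>) (g << cd.2 >>)).

Definition hmul : Hqp2 K -> Hqp K := linext (fun cd => << cd.1 >> * << cd.2 >>).

Definition coprod_icl (c : isoclass) : Hqp2 K :=
  \sum_(O | qopen (irep c) O)
    << (icl (qrestr (irep c) (~: O)), icl (qrestr (irep c) O)) >>.

Definition hcoprod : Hqp K -> Hqp2 K := linext coprod_icl.

Definition hcounit (h : Hqp K) : K := h@_iempty.

Definition is_antipode (S : Hqp K -> Hqp K) : Prop :=
  [/\ linear S,
      forall h, hmul (tensmap S id (hcoprod h)) = (hcounit h)%:A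
    & forall h, hmul (tensmap id S (hcoprod h)) = (hcounit h)%:A].

Definition algebra_morphism (f : Hqp K -> Hqp K) : Prop :=
  [/\ linear f, f 1 = 1 & {morph f : g h / g * h}].

Definition coalgebra_morphism (f : Hqp K -> Hqp K) : Prop :=
  [/\ linear f, forall h, hcoprod (f h) = tensmap f f (hcoprod h)
    & forall h, hcounit (f h) = hcounit h].

Definition hopf_morphism (f : Hqp K -> Hqp K) : Prop :=
  [/\ algebra_morphism f, coalgebra_morphism f
    & forall S, is_antipode S -> forall h, f (S h) = S (f h)].

Definition hopf_automorphism (f : Hqp K -> Hqp K) : Prop :=
  hopf_morphism f /\ bijective f.

Definition theta_icl (c : isoclass) : Hqp K :=
  \sum_(E | qcompat E (irep c)) << icl (qquot (irep c) E) >>.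

Definition theta : Hqp K -> Hqp K := linext theta_icl.

Definition theta_inv_icl (c : isoclass) : Hqp K :=
  \sum_(E | qcompat E (irep c))
    (-1) ^+ (ncl (eqv_rel E) + ncl (qsim (irep c))) *:
      << icl (qquot (irep c) E) >>.

Definition theta_inv : Hqp K -> Hqp K := linext theta_inv_icl.

End HopfStructure.

(* Maps to {1, ..., k} are encoded, up to the shift by 1, as maps to 'I_k.    *)
Definition qL (A : finType) (P : qposet A) (k : nat) : {set {ffun A -> 'I_k}} :=
  [set f : {ffun A -> 'I_k} |
     [forall i, forall j, qle P i j ==> (f i <= f j)%N]].

Definition qLstr (A : finType) (P : qposet A) (k : nat) :
    {set {ffun A -> 'I_k}} :=
  [set f in qL P k |
     [forall i, forall j, qle P i j && (f i == f j) ==> qsim P i j]].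

Definition interpolates (K : fieldType) (u : nat -> nat) (p : {poly K}) : Prop :=
  forall k, (0 < k)%N -> p.[k%:R] = (u k)%:R.

(* The polynomial taking the values u k for k >= 1, unique in characteristic 0. *)
Definition interp (K : fieldType) (u : nat -> nat) : {poly K} :=
  epsilon (inhabits 0) (interpolates u).

Definition ehr_poly (K : fieldType) (A : finType) (P : qposet A) : {poly K} :=
  interp K (fun k => #|qL P k|).

Definition ehr_str_poly (K : fieldType) (A : finType) (P : qposet A) :
    {poly K} :=
  interp K (fun k => #|qLstr P k|).

Definition ehr (K : fieldType) : Hqp K -> {poly K} :=
  linext (fun c => ehr_poly K (irep c)).

Definition ehr_str (K : fieldType) : Hqp K -> {poly K} :=
  linext (fun c => ehr_str_poly K (irep c)).

Lemma iclM (K : fieldType) A B (P : qposet A) (Q : qposet B) :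
  (<< icl P >> : Hqp K) * << icl Q >> = << icl (qsum P Q) >>.
Proof.
have := fgmulUU (1 : K) 1 (icl P) (icl Q).
by rewrite -malgM_def mulr1 -imulE.
Qed.

Section Transport.
Variables (A B : finType) (P : qposet A) (Q : qposet B).
Variables (f : A -> B) (g : B -> A).
Hypotheses (fK : cancel f g) (gK : cancel g f).
Hypothesis hf : forall x y, qle P x y = qle Q (f x) (f y).

Lemma qsim_tr x y : qsim P x y = qsim Q (f x) (f y).
Proof. by rewrite /qsim !hf. Qed.

Lemma qopen_tr (O : {set B}) : qopen P (f @^-1: O) = qopen Q O.
Proof.
apply/forallP/forallP => h x; apply/forallP => y.
  by move/forallP: (h (g x)) => /(_ (g y)); rewrite !inE hf !gK.
by move/forallP: (h (f x)) => /(_ (f y)); rewrite !inE hf.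
Qed.

Lemma preim_bij : bijective (fun O : {set B} => f @^-1: O).
Proof.
exists (fun O : {set A} => g @^-1: O) => O; apply/setP => x;
by rewrite !inE ?fK ?gK.
Qed.

Lemma restr_tr (O : {set B}) :
  isomorphic (qrestr P (f @^-1: O)) (qrestr Q O).
Proof.
have hO (x : {x | x \in f @^-1: O}) : f (val x) \in O.
  by case: x => x /=; rewrite inE.
have hO' (x : {x | x \in O}) : g (val x) \in f @^-1: O.
  by case: x => x /=; rewrite inE gK.
exists (fun x => exist _ (f (val x)) (hO x)).
  by exists (fun x => exist _ (g (val x)) (hO' x)) => x; apply: val_inj;
    rewrite /= ?fK ?gK.
by move=> x y; rewrite !qposet_ofE hf.
Qed.

Lemma qconnected_tr : qconnected P -> qconnected Q.
Proof.
move=> /forallP h; apply/forallP => O.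
move: (h (f @^-1: O)); rewrite -preimsetC !qopen_tr => /implyP i.
apply/implyP => /i; rewrite -(inj_eq (bij_inj preim_bij) O).
by rewrite -(inj_eq (bij_inj preim_bij) O setT) preimsetT preimset0.
Qed.

Lemma eqv_pull_subproof (E : eqv B) :
  equiv_graph [set u | eqv_rel E (f u.1) (f u.2)].
Proof.
case: E => r; rewrite /equiv_graph /eqv_rel /= => /andP[/andP[/forallP r1]].
move=> /forallP r2 /forallP r3; apply/andP; split; first (apply/andP; split).
- by apply/forallP => x; rewrite inE.
- apply/forallP => x; apply/forallP => y; apply/forallP => z; rewrite !inE /=.
  by move/forallP: (r2 (f x)) => /(_ (f y))/forallP/(_ (f z)).
apply/forallP => x; apply/forallP => y; rewrite !inE.
by move/forallP: (r3 (f x)) => /(_ (f y)).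
Qed.

Definition eqv_pull (E : eqv B) : eqv A := Eqv (eqv_pull_subproof E).

Lemma eqv_pullE (E : eqv B) x y :
  eqv_rel (eqv_pull E) x y = eqv_rel E (f x) (f y).
Proof. by rewrite /eqv_rel /= inE. Qed.

Lemma qquot_tr (E : eqv B) x y :
  qle (qquot P (eqv_pull E)) x y = qle (qquot Q E) (f x) (f y).
Proof.
rewrite !qposet_ofE; apply/connectP/connectP => -[p].
  move=> hp ->; exists (map f p); last by rewrite last_map.
  elim: p x hp => //= z p IH x /andP[h /IH ->]; rewrite andbT.
  by move: h; rewrite /= hf eqv_pullE.
move=> hp e; exists (map g p); last by rewrite -[x]fK last_map -e fK.
rewrite -[x]fK; elim: p (f x) hp {e} => //= z p IH t /andP[h /IH ->].
by rewrite andbT /= hf eqv_pullE !gK.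
Qed.

Lemma eqpart_tr (e : rel B) (e' : rel A) :
    (forall x y, e' x y = e (f x) (f y)) ->
  equivalence_partition e' [set: A] =
  (fun O : {set B} => f @^-1: O) @: equivalence_partition e [set: B].
Proof.
move=> he; apply/setP => O; apply/imsetP/imsetP => [[x _ ->]|[O' /imsetP[y _ ->] ->]].
  exists [set y in setT | e (f x) y]; first by apply/imsetP; exists (f x).
  by apply/setP => y; rewrite !inE he.
by exists (g y) => //; apply/setP => x; rewrite !inE he gK.
Qed.

Lemma ncl_tr (e : rel B) (e' : rel A) :
  (forall x y, e' x y = e (f x) (f y)) -> ncl e' = ncl e.
Proof.
by move=> he; rewrite /ncl (eqpart_tr he) card_imset //; apply/bij_inj/preim_bij.
Qed.

End Transport.

Lemma qconnected_iso A B (P : qposet A) (Q : qposet B) :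
  isomorphic P Q -> qconnected P = qconnected Q.
Proof.
move=> h; apply/idP/idP; first by case: h => f [g fK gK] h; apply: qconnected_tr h.
by case: (iso_sym h) => f [g fK gK] {}h; apply: qconnected_tr h.
Qed.

Section Transport2.
Variables (A B : finType) (P : qposet A) (Q : qposet B).
Variables (f : A -> B) (g : B -> A).
Hypotheses (fK : cancel f g) (gK : cancel g f).
Hypothesis hf : forall x y, qle P x y = qle Q (f x) (f y).

Lemma qcompat_tr (E : eqv B) : qcompat (eqv_pull f E) P = qcompat E Q.
Proof.
congr andb.
  rewrite (eqpart_tr gK (eqv_pullE f E)).
  apply/forall_inP/forall_inP => h O hO.
    by rewrite -(qconnected_iso (restr_tr fK gK hf O)) h ?imset_f.
  case/imsetP: hO => O' hO' ->.
  by rewrite (qconnected_iso (restr_tr fK gK hf O')) h.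
have hq := qquot_tr fK gK hf E.
apply/forallP/forallP => h x; apply/forallP => y.
  move/forallP: (h (g x)) => /(_ (g y)).
  by rewrite /qsim !hq eqv_pullE !gK.
move/forallP: (h (f x)) => /(_ (f y)).
by rewrite /qsim !hq eqv_pullE.
Qed.

Lemma eqv_pull_bij : bijective (eqv_pull f).
Proof.
by exists (eqv_pull g) => E; apply/val_inj/setP => -[x y];
  rewrite inE /= /eqv_rel /= inE /= ?fK ?gK.
Qed.

Lemma qL_tr k : #|qL P k| = #|qL Q k|.
Proof.
pose h (u : {ffun B -> 'I_k}) : {ffun A -> 'I_k} := [ffun x => u (f x)].
have hb : bijective h.
  by exists (fun u : {ffun A -> 'I_k} => [ffun y => u (g y)]) => u;
    apply/ffunP => x; rewrite !ffunE ?fK ?gK.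
rewrite -(on_card_preimset (onW_bij _ hb)); congr #|pred_of_set _|.
apply/setP => u; rewrite !inE.
apply/forallP/forallP => H x; apply/forallP => y.
  by move/forallP: (H (g x)) => /(_ (g y)); rewrite !ffunE hf !gK.
by move/forallP: (H (f x)) => /(_ (f y)); rewrite !ffunE hf.
Qed.

Lemma qLstr_tr k : #|qLstr P k| = #|qLstr Q k|.
Proof.
pose h (u : {ffun B -> 'I_k}) : {ffun A -> 'I_k} := [ffun x => u (f x)].
have hb : bijective h.
  by exists (fun u : {ffun A -> 'I_k} => [ffun y => u (g y)]) => u;
    apply/ffunP => x; rewrite !ffunE ?fK ?gK.
rewrite -(on_card_preimset (onW_bij _ hb)); congr #|pred_of_set _|.
apply/setP => u; rewrite !inE; congr andb.
  apply/forallP/forallP => H x; apply/forallP => y.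
    by move/forallP: (H (g x)) => /(_ (g y)); rewrite !ffunE hf !gK.
  by move/forallP: (H (f x)) => /(_ (f y)); rewrite !ffunE hf.
apply/forallP/forallP => H x; apply/forallP => y.
  by move/forallP: (H (g x)) => /(_ (g y)); rewrite !ffunE hf (qsim_tr hf) !gK.
by move/forallP: (H (f x)) => /(_ (f y)); rewrite !ffunE hf (qsim_tr hf).
Qed.
End Transport2.

Section BasisFormulas.
Variables (K : fieldType) (A : finType) (P : qposet A).

Lemma hcoprodE : hcoprod << icl P >> =
  \sum_(O | qopen P O) << (icl (qrestr P (~: O)), icl (qrestr P O)) >>
  :> Hqp2 K.
Proof.
rewrite /hcoprod linextU /coprod_icl; case: (irep_icl P) => f [g fK gK] hf.
rewrite (reindex _ (onW_bij _ (preim_bij fK gK))) /=.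
apply: eq_big => O; first by rewrite (qopen_tr gK hf).
move=> _; rewrite -preimsetC.
by rewrite !(proj2 (iclP _ _) (restr_tr fK gK hf _)).
Qed.

Lemma thetaE : theta << icl P >> =
  \sum_(E | qcompat E P) << icl (qquot P E) >> :> Hqp K.
Proof.
rewrite /theta linextU /theta_icl; case: (irep_icl P) => f [g fK gK] hf.
rewrite (reindex _ (onW_bij _ (eqv_pull_bij fK gK))) /=.
apply: eq_big => E; first by rewrite (qcompat_tr fK gK hf).
move=> _; congr << _ >>; apply/iclP; exists f; first by exists g.
by move=> x y; rewrite (qquot_tr fK gK hf).
Qed.

Lemma theta_invE : theta_inv << icl P >> =
  \sum_(E | qcompat E P)
    (-1) ^+ (ncl (eqv_rel E) + ncl (qsim P)) *: << icl (qquot P E) >> :> Hqp K.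
Proof.
rewrite /theta_inv linextU /theta_inv_icl; case: (irep_icl P) => f [g fK gK] hf.
rewrite (reindex _ (onW_bij _ (eqv_pull_bij fK gK))) /=.
apply: eq_big => E; first by rewrite (qcompat_tr fK gK hf).
move=> _; rewrite (ncl_tr fK gK (eqv_pullE f E)).
rewrite (ncl_tr fK gK (qsim_tr hf)).
congr (_ *: << _ >>); apply/iclP; exists f; first by exists g.
by move=> x y; rewrite (qquot_tr fK gK hf).
Qed.

End BasisFormulas.

Section Interpolation.
Variable K : fieldType.
Hypothesis charK : [pchar K] =i pred0.

Lemma natr_inj_char0 : injective (fun n : nat => n%:R : K).
Proof.
have h m n : (m <= n)%N -> m%:R = n%:R :> K -> m = n.
  move=> le /eqP; rewrite eq_sym -subr_eq0 -natrB // (pcharf0P K).1 //.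
  by rewrite subn_eq0 => le'; apply/eqP; rewrite eqn_leq le.
by move=> m n e; case/orP: (leq_total m n) => le; [|apply/esym]; apply: h.
Qed.

Lemma interpolates_uniq u (p q : {poly K}) :
  interpolates u p -> interpolates u q -> p = q.
Proof.
move=> hp hq; apply/eqP; rewrite -subr_eq0; apply/eqP.
pose s : seq K := [seq (i.+1)%:R | i <- iota 0 (size (p - q))].
apply: (@roots_geq_poly_eq0 _ _ s); last by rewrite size_map size_iota.
  apply/allP => _ /mapP[i _ ->].
  by rewrite rootE hornerD hornerN hp // hq // subrr.
by rewrite map_inj_uniq ?iota_uniq // => i j /natr_inj_char0[].
Qed.

Lemma interpE u (p : {poly K}) : interpolates u p -> interp K u = p.
Proof.
by move=> hp; apply: (@interpolates_uniq u) => //; apply: epsilon_spec; exists p.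
Qed.

Lemma binomial_interp j :
  exists p : {poly K}, forall k, p.[k%:R] = 'C(k, j)%:R.
Proof.
exists (j`!%:R^-1 *: \prod_(i < j) ('X - i%:R%:P)) => k.
have j0 : j`!%:R != 0 :> K by rewrite (pcharf0P K).1 // -lt0n fact_gt0.
apply: (mulfI j0); rewrite hornerZ mulVKf // -natrM mulnC bin_ffact.
rewrite horner_prod ffact_prod natr_prod.
have [le|lt] := leqP j k.
  apply: eq_bigr => i _; rewrite hornerXsubC natrB //.
  exact: leq_trans (ltnW (ltn_ord i)) le.
rewrite (bigD1 (Ordinal lt)) //= hornerXsubC subrr mul0r.
by rewrite [RHS](bigD1 (Ordinal lt)) //= subnn mul0r.
Qed.

Lemma enum_val_mono k (S : {set 'I_k}) (i j : 'I_#|S|) :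
  ((enum_val i <= enum_val j) = (i <= j))%N.
Proof.
have st : sorted ltn [seq val x | x <- enum S].
  apply: (subseq_sorted ltn_trans (s2 := map val (enum 'I_k))).
    by apply: map_subseq; rewrite enumT; apply: filter_subseq.
  by rewrite val_enum_ord iota_ltn_sorted.
have nthE (t : 'I_#|S|) : nth 0%N [seq val x | x <- enum S] t = enum_val t.
  by rewrite (nth_map (enum_val t)) -?cardE ?ltn_ord -?enum_val_nth.
have := sorted_leq_nth leq_trans leqnn 0%N (sub_sorted (fun x y => @ltnW x y) st).
have lt := sorted_ltn_nth ltn_trans 0%N st.
move=> le; apply/idP/idP; last first.
  by move=> ij; rewrite -!nthE le // inE size_map -cardE.
apply: contraTT; rewrite -!ltnNge -!nthE => ji.
by apply: lt => //; rewrite inE size_map -cardE.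
Qed.

Lemma count_interp (A : finType) (Q : (A -> nat) -> bool) :
    (forall f g : A -> nat,
       (forall x y, (f x <= f y) = (g x <= g y))%N -> Q f = Q g) ->
  exists p : {poly K},
    interpolates (fun k => #|[set f : {ffun A -> 'I_k} | Q (fun x => f x)]|) p.
Proof.
move=> hQ.
pose s j := #|[set f : {ffun A -> 'I_j} | Q (fun x => f x) & f @: setT == setT]|.
have [b hb] : exists b : nat -> {poly K},
    forall j k, (b j).[k%:R] = 'C(k, j)%:R.
  exists (fun j => epsilon (inhabits 0) (fun p : {poly K} =>
     forall k, p.[k%:R] = 'C(k, j)%:R)) => j.
  exact: (epsilon_spec _ _ (binomial_interp j)).
exists (\sum_(j < #|A|.+1) (s j)%:R *: b j) => k _.
have cntS (S : {set 'I_k}) :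
    #|[set f : {ffun A -> 'I_k} | Q (fun x => f x) & f @: setT == S]| = s #|S|.
  pose h (g : {ffun A -> 'I_#|S|}) : {ffun A -> 'I_k} := [ffun x => enum_val (g x)].
  have hi : injective h.
    by move=> g g' /ffunP e; apply/ffunP => x; have := e x;
       rewrite !ffunE => /enum_val_inj.
  rewrite /s -(card_imset _ hi); congr #|pred_of_set _|.
  have Qh g : Q (fun x => h g x) = Q (fun x => g x).
    by apply: hQ => x y; rewrite !ffunE enum_val_mono.
  have imh g : h g @: setT = enum_val @: (g @: setT).
    by rewrite -imset_comp; apply: eq_imset => x; rewrite ffunE.
  have imT : enum_val @: [set: 'I_#|S|] = S.
    apply/setP => x; apply/imsetP/idP => [[i _ ->]|xS]; first exact: enum_valP.
    by exists (enum_rank_in xS x) => //; rewrite enum_rankK_in.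
  apply/setP => f; apply/idP/imsetP => [|[g]]; rewrite inE; last first.
    by case/andP => qg /eqP gT ->; rewrite inE Qh qg imh gT imT eqxx.
  case/andP => qf /eqP fS.
  have fx x : f x \in S by rewrite -fS imset_f.
  pose g : {ffun A -> 'I_#|S|} := [ffun x => enum_rank_in (fx x) (f x)].
  have fE : f = h g by apply/ffunP => x; rewrite !ffunE enum_rankK_in.
  exists g => //; rewrite inE -Qh -fE qf /=; apply/eqP.
  by apply: (imset_inj (@enum_val_inj _ _)); rewrite -imh -fE fS imT.
have -> : #|[set f : {ffun A -> 'I_k} | Q (fun x => f x)]| =
    (\sum_(S : {set 'I_k}) s #|S|)%N.
  rewrite -sum1_card (partition_big (fun f : {ffun A -> 'I_k} => f @: setT) xpredT) //=.
  apply: eq_bigr => S _; rewrite -cntS -sum1_card; apply: eq_bigl => f.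
  by rewrite !inE.
have s0 j : (#|A| < j)%N -> s j = 0%N.
  move=> lt; apply/eqP; rewrite cards_eq0; apply/eqP/setP => f; rewrite !inE.
  apply/negbTE; apply/negP => /andP[_ /eqP fT].
  have := leq_imset_card f setT.
  by rewrite fT !cardsT card_ord leqNgt lt.
have -> : (\sum_(S : {set 'I_k}) s #|S|)%N =
    (\sum_(j < #|A|.+1) s j * 'C(k, j))%N.
  rewrite (bigID (fun S : {set 'I_k} => (#|S| < #|A|.+1)%N)) /=.
  rewrite [X in (_ + X)%N]big1 ?addn0; last first.
    by move=> S; rewrite -leqNgt => /s0.
  rewrite (partition_big (fun S : {set 'I_k} => inord #|S| : 'I_#|A|.+1) xpredT) //=.
  apply: eq_bigr => j _.
  rewrite (eq_bigl (fun S : {set 'I_k} => S \in [set S : {set 'I_k} | #|S| == j])).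
    rewrite (eq_bigr (fun=> s j)); last by move=> S; rewrite inE => /eqP ->.
    by rewrite sum_nat_const card_draws card_ord mulnC.
  move=> S; rewrite inE; apply/andP/eqP => [[lt /eqP <-]|e].
    by rewrite inordK.
  by rewrite e ltn_ord; split=> //; rewrite inord_val.
rewrite natr_sum horner_sum; apply: eq_bigr => j _.
by rewrite hornerZ hb natrM.
Qed.

Lemma ehr_poly_spec A (P : qposet A) :
  interpolates (fun k => #|qL P k|) (ehr_poly K P).
Proof.
apply: epsilon_spec.
apply: (@count_interp A (fun f => [forall i, forall j, qle P i j ==> (f i <= f j)%N])).
by move=> f g h; do 2!apply: eq_forallb => ?; rewrite h.
Qed.

Lemma ehr_str_poly_spec A (P : qposet A) :
  interpolates (fun k => #|qLstr P k|) (ehr_str_poly K P).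
Proof.
apply: epsilon_spec.
have [f g h|p hp] := @count_interp A (fun f =>
  [forall i, forall j, qle P i j ==> (f i <= f j)%N] &&
  [forall i, forall j, qle P i j && (f i == f j) ==> qsim P i j]).
  by congr andb; do 2!apply: eq_forallb => ?; rewrite ?eqn_leq ?h.
exists p => k k0; rewrite hp //; congr (#|pred_of_set _|%:R).
by apply/setP => f; rewrite !inE.
Qed.

Lemma ehrE A (P : qposet A) : ehr << icl P >> = ehr_poly K P.
Proof.
rewrite /ehr linextU; apply: (@interpolates_uniq (fun k => #|qL P k|)).
  case: (irep_icl P) => f [g fK gK] hf k k0.
  by rewrite ehr_poly_spec // (qL_tr fK gK hf).
exact: ehr_poly_spec.
Qed.

Lemma ehr_strE A (P : qposet A) : ehr_str << icl P >> = ehr_str_poly K P.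
Proof.
rewrite /ehr_str linextU; apply: (@interpolates_uniq (fun k => #|qLstr P k|)).
  case: (irep_icl P) => f [g fK gK] hf k k0.
  by rewrite ehr_str_poly_spec // (qLstr_tr fK gK hf).
exact: ehr_str_poly_spec.
Qed.

End Interpolation.

(* Main.v *)
From HB Require Import structures.
Require Import Defs.
From mathcomp Require Import all_boot all_order all_algebra finmap.
From mathcomp Require Import monalg.

Set Implicit Arguments.
Unset Strict Implicit.
Unset Printing Implicit Defensive.

Import GRing.Theory.
Local Open Scope ring_scope.

(** Everything rests on two bijections between compatible equivalences.

    Cutting along an open set.  Let O be open in P.  An equivalence E <| P for
    which O is still open in P/E never relates O to its complement, so it is
    the disjoint union of its two restrictions, and these are arbitrary
    equivalences compatible with P|(A \ O) and P|O ([sum_compat_open]).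
    Summing over O, this says that theta commutes with the coproduct; applied
    to the clopen summand of a disjoint union it says that theta is
    multiplicative.  The counit is immediate.  The antipode is determined by
    convolution: theta o S and S o theta are both left convolution inverses of
    theta, and right convolution by a function equal to 1 on the empty
    quasi-poset is injective, by induction on the number of points
    ([conv_inj]).

    Exchanging two contractions.  Write P /\ F for the quasi-order
    (x <= y and x F y).  Then (E <| P and F <| P/E) iff
    (F <| P and E <| P /\ F), and in that case (P/E)/F = P/F
    ([qcompat_exchange], [qquot_qquot]).  Hence both composites of theta and
    of the signed map of the theorem send P to a sum over F <| P of P/F, with
    a coefficient which is, up to sign, chi(P /\ F), where chi(P) is the sum
    of (-1)^cl(E) over E <| P.

    It remains to show that chi(P) is (-1)^cl(P) if the quasi-order P is
    symmetric, and 0 otherwise ([sum_compat_sgn]); for F <| P the quasi-order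
    P /\ F is symmetric only when F is the equivalence of P, so a single term
    P survives.  Here chi is (-1)^cl composed with theta.  Let delta be the
    indicator of symmetric quasi-orders.  Adding or removing a maximal class
    changes the sign, so the convolution (-1)^cl * delta vanishes on nonempty
    quasi-posets; composing with theta, under which delta becomes the
    constant 1, gives the same for chi * 1.  Toggling a minimal class shows
    that ((-1)^cl delta) * 1 vanishes on nonempty quasi-posets too, and
    right convolution by 1 is injective.

    Finally ehr^str o theta = ehr is a partition of L_P(k): a monotone map f
    is strict for exactly one contraction P/E, where the classes of E are the
    connected components of the fibres of f ([mem_qLstr_quot]).  The last
    identity follows by composing with the inverse of theta. *)

(** * Paths in finite relations *)

Section Paths.

Lemma connect_min (T : finType) (r s : rel T) :
  reflexive s -> transitive s -> subrel r s -> subrel (connect r) s.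
Proof.
move=> sr st rs x y /connectP[p hp ->]; elim: p x hp => //= z p IH x.
by case/andP=> /rs xz /IH; apply: st.
Qed.

(** A path from [h u] to [h v] can be rewritten step by step inside [U], where
    at each step one may use that its ends lie between [h u] and [h v].  With
    [h] the identity this changes the relation; with [h] an inclusion it keeps
    the path inside a subset. *)
Lemma connect_between (T U : finType) (h : U -> T) (r : rel T) (r' : rel U) u v :
    (forall z, connect r (h u) z -> connect r z (h v) -> exists w, h w = z) ->
    injective h ->
    (forall a b, connect r (h u) (h a) -> r (h a) (h b) ->
       connect r (h b) (h v) -> connect r' a b) ->
  connect r (h u) (h v) -> connect r' u v.
Proof.
move=> hz hi hs /connectP[p hp ev].
suff gen a : connect r (h u) (h a) -> path r (h a) p -> h v = last (h a) p ->
    connect r' a v by apply: gen hp ev; apply: connect0.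
elim: p a {hp ev} => [|z p IH] a ua /=; first by move=> _ /hi ->.
case/andP=> az hp ev.
have zv : connect r z (h v) by apply/connectP; exists p.
have [w ew] := hz z (connect_trans ua (connect1 az)) zv.
rewrite -ew in az hp ev zv.
apply: connect_trans (hs _ _ ua az zv) (IH w _ hp ev).
exact: connect_trans ua (connect1 az).
Qed.

Lemma connect_map (T U : finType) (h : U -> T) (r : rel T) (r' : rel U) u v :
    (forall a b, r' a b -> r (h a) (h b)) ->
  connect r' u v -> connect r (h u) (h v).
Proof.
move=> hr; apply: (@connect_min _ _ (relpre h (connect r))) => [x|y x z|a b /hr] /=.
- exact: connect0.
- exact: connect_trans.
- exact: connect1.
Qed.

Lemma connect_subrel (T : finType) (r s : rel T) x y :
  subrel r s -> connect r x y -> connect s x y.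
Proof. by move=> h; apply: connect_sub => {x y} x y /h; apply: connect1. Qed.

End Paths.

(** * Compatible equivalences and their exchange *)

Section Equivalences.
Variable A : finType.
Implicit Types (E F : eqv A) (P : qposet A).

Lemma eqv_refl E : reflexive (eqv_rel E).
Proof. 
move=> x; have /andP[/andP[/forallP h _] _] := eqv_graphP E; exact: h. Qed.

Lemma eqv_trans E : transitive (eqv_rel E).
Proof.
move=> y x z xy yz; have /andP[/andP[_ h] _] := eqv_graphP E.
move/forallP: h => /(_ x)/forallP/(_ y)/forallP/(_ z)/implyP; apply.
exact/andP.
Qed.

Lemma eqv_symm E : symmetric (eqv_rel E).
Proof.
have h x y : eqv_rel E x y -> eqv_rel E y x.
  have /andP[_ h] := eqv_graphP E.
  by move/forallP: h => /(_ x)/forallP/(_ y)/implyP.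
by move=> x y; apply/idP/idP; apply: h.
Qed.

Lemma eqvP E F : eqv_rel E =2 eqv_rel F -> E = F.
Proof. by move=> e; apply/val_inj/setP => -[x y]; apply: e. Qed.

Lemma rel_equiv_graph (r : rel A) :
  reflexive r -> symmetric r -> transitive r -> equiv_graph [set u | r u.1 u.2].
Proof.
move=> rr rs rt; rewrite /equiv_graph rel_quasi_order //=.
by apply/forallP => x; apply/forallP => y; rewrite !inE /= rs implybb.
Qed.

Definition eqv_of (r : rel A) (rr : reflexive r) (rs : symmetric r)
    (rt : transitive r) : eqv A := Eqv (rel_equiv_graph rr rs rt).

Lemma eqv_ofE (r : rel A) rr rs rt : eqv_rel (@eqv_of r rr rs rt) =2 r.
Proof. by move=> x y; rewrite /eqv_rel /= inE. Qed.

Lemma qsim_symm P : symmetric (qsim P).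
Proof. by move=> x y; rewrite /qsim andbC. Qed.

Lemma qsim_refl P : reflexive (qsim P).
Proof. by move=> x; rewrite /qsim qle_refl. Qed.

Lemma qsim_trans P : transitive (qsim P).
Proof.
move=> y x z /andP[xy yx] /andP[yz zy].
by rewrite /qsim (qle_trans xy yz) (qle_trans zy yx).
Qed.

Definition eqv_sim P : eqv A :=
  eqv_of (@qsim_refl P) (@qsim_symm P) (@qsim_trans P).

Lemma eqv_simE P : eqv_rel (eqv_sim P) =2 qsim P.
Proof. exact: eqv_ofE. Qed.

Lemma eq_ncl (e e' : rel A) : e =2 e' -> ncl e = ncl e'.
Proof. by move=> he; apply: (@ncl_tr _ _ id id) => // x y; rewrite he. Qed.

(** The comparabilities of [P] inside the classes of [E]: the classes of [E]
    are connected in [P] exactly when these generate [E]. *)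
Definition zigzag P E : rel A :=
  fun x y => eqv_rel E x y && (qle P x y || qle P y x).

Lemma zigzag_symm P E : connect_sym (zigzag P E).
Proof.
by apply: sym_connect_sym => x y; rewrite /zigzag eqv_symm orbC.
Qed.

Lemma zigzag_sub P E x y : connect (zigzag P E) x y -> eqv_rel E x y.
Proof.
apply: (connect_min (@eqv_refl E) (@eqv_trans E)) => {x y} x y.
by case/andP.
Qed.

Lemma le_qquot P E x y : qle P x y -> qle (qquot P E) x y.
Proof. by move=> h; rewrite qposet_ofE connect1 //= h. Qed.

Lemma eqv_qquot P E x y : eqv_rel E x y -> qle (qquot P E) x y.
Proof. by move=> h; rewrite qposet_ofE connect1 //= h orbT. Qed.

Lemma qquot_min P E Q :
    (forall x y, qle P x y -> qle Q x y) ->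
    (forall x y, eqv_rel E x y -> qle Q x y) ->
  forall x y, qle (qquot P E) x y -> qle Q x y.
Proof.
move=> h1 h2 x y; rewrite qposet_ofE.
apply: (connect_min (@qle_refl _ Q) (@qle_trans _ Q)) => {x y} x y /=.
by case/orP; [apply: h1|apply: h2].
Qed.

(** Compatibility in terms of paths only, so that no restriction of [P] to a
    class is left.  If the classes are connected, the points reachable from
    [x] by zigzags form a clopen subset of the class of [x], hence all of it;
    conversely a clopen subset of a class is closed under zigzags. *)
Lemma qcompatP E P :
  reflect ((forall x y, eqv_rel E x y -> connect (zigzag P E) x y) /\
           (forall x y, qsim (qquot P E) x y -> eqv_rel E x y))
          (qcompat E P).
Proof.
pose cl x := [set y in [set: A] | eqv_rel E x y].
apply: (iffP andP) => [[/forall_inP h1 /forallP h2]|[h1 h2]]; split.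
- move=> x y xy.
  have xB : x \in cl x by rewrite !inE eqv_refl.
  have yB : y \in cl x by rewrite !inE.
  have /h1/forallP : cl x \in equivalence_partition (eqv_rel E) [set: A].
    by apply/imsetP; exists x.
  move/(_ [set u | connect (zigzag P E) x (val u)])/implyP => imp.
  have zz (u v : {z | z \in cl x}) : qle P (val u) (val v) ->
      connect (zigzag P E) x (val u) = connect (zigzag P E) x (val v).
    move=> uv; apply: same_connect_r; first exact: zigzag_symm.
    apply/connect1; rewrite /zigzag uv andbT.
    case: u v {uv} => u /= + [v /=]; rewrite !inE => xu xv.
    by rewrite (eqv_trans _ xv) // eqv_symm.
  suff /imp : qopen (qrestr P (cl x)) [set u | connect (zigzag P E) x (val u)] &&
      qopen (qrestr P (cl x)) (~: [set u | connect (zigzag P E) x (val u)]).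
    case/orP=> /eqP/setP h.
      by move: (h (Sub x xB)); rewrite !inE connect0.
    by move: (h (Sub y yB)); rewrite !inE.
  apply/andP; split; apply/forallP => u; apply/forallP => v; apply/implyP;
    by rewrite !inE qposet_ofE => /andP[h uv]; rewrite -(zz u v uv).
- by move=> x y; move/forallP: (h2 x) => /(_ y)/eqP ->.
- apply/forall_inP => B /imsetP[x0 _ ->]; rewrite -/(cl x0).
  apply/forallP => O; apply/implyP => /andP[oO oC].
  pose r' : rel {x | x \in cl x0} :=
    fun u v => qle P (val u) (val v) || qle P (val v) (val u).
  have cO : closed r' O.
    have step u v : qle P (val u) (val v) -> (u \in O) = (v \in O).
      move=> uv; apply/idP/idP => h.
        move/forallP: oO => /(_ u)/forallP/(_ v)/implyP; apply.
        by rewrite h qposet_ofE.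
      apply: contraLR h => h.
      move/forallP: oC => /(_ u)/forallP/(_ v); rewrite !inE h qposet_ofE.
      by move/implyP; apply.
    by move=> u v /orP[/step|/step].
  have conn u v : connect r' u v.
    have /= ue := valP u; have /= ve := valP v; rewrite !inE in ue ve.
    have uv : eqv_rel E (val u) (val v) by rewrite (eqv_trans _ ve) // eqv_symm.
    apply: (@connect_between _ _ val (zigzag P E)) (h1 _ _ uv).
    - move=> z /zigzag_sub uz _.
      have zB : z \in cl x0 by rewrite !inE (eqv_trans ue uz).
      by exists (Sub z zB).
    - exact: val_inj.
    - by move=> a b _ /andP[_ ab] _; apply/connect1.
  case: (set_0Vmem O) => [->|[u uO]]; first by rewrite eqxx.
  apply/orP; right; apply/eqP/setP => v; rewrite inE.
  by rewrite -(closed_connect cO (conn u v)).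
apply/forallP => x; apply/forallP => y; apply/eqP; apply/idP/idP; first exact: h2.
by move=> xy; rewrite /qsim !eqv_qquot // eqv_symm.
Qed.

Lemma qcompat_sim P E : qcompat E P -> qsim (qquot P E) =2 eqv_rel E.
Proof.
case/qcompatP=> _ h x y; apply/idP/idP; first exact: h.
by move=> xy; rewrite /qsim !eqv_qquot // eqv_symm.
Qed.

Lemma qquot_mono P E F : (forall x y, eqv_rel E x y -> eqv_rel F x y) ->
  forall x y, qle (qquot P E) x y -> qle (qquot P F) x y.
Proof.
move=> EF; apply: qquot_min => x y; first exact: le_qquot.
by move/EF; apply: eqv_qquot.
Qed.

Lemma qquot_qquot P E F : (forall x y, eqv_rel E x y -> eqv_rel F x y) ->
  qquot (qquot P E) F = qquot P F.
Proof.
move=> EF; apply: qposetP => x y; apply/idP/idP.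
  apply: qquot_min => {x y} x y; last exact: eqv_qquot.
  exact: qquot_mono EF _ _.
apply: qquot_min => {x y} x y; last exact: eqv_qquot.
by move=> xy; do 2!apply: le_qquot.
Qed.

Lemma qquot_sim P : qquot P (eqv_sim P) = P.
Proof.
apply: qposetP => x y; apply/idP/idP; last exact: le_qquot.
by apply: qquot_min => {x y} x y //; rewrite eqv_simE => /andP[].
Qed.

Lemma qcompat_eqv_sim P : qcompat (eqv_sim P) P.
Proof.
apply/qcompatP; split=> x y; last by rewrite qquot_sim eqv_simE.
by move=> xy; apply/connect1; rewrite /zigzag xy; move: xy; rewrite eqv_simE => /andP[->].
Qed.

Lemma qmeet_trans P E : transitive (fun x y => qle P x y && eqv_rel E x y).
Proof.
move=> y x z /andP[xy exy] /andP[yz eyz].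
by rewrite (qle_trans xy yz) (eqv_trans exy eyz).
Qed.

Lemma qmeet_refl P E : reflexive (fun x y => qle P x y && eqv_rel E x y).
Proof. by move=> x; rewrite qle_refl eqv_refl. Qed.

(** The relations of [P] inside the classes of [E]: the disjoint union of the
    restrictions of [P] to these classes, without changing the carrier. *)
Definition qmeet P E : qposet A := qposet_of (@qmeet_refl P E) (@qmeet_trans P E).

Lemma qmeetE P E x y : qle (qmeet P E) x y = qle P x y && eqv_rel E x y.
Proof. by rewrite qposet_ofE. Qed.

Lemma qcompat_sub P E F : qcompat E P -> qcompat F (qquot P E) ->
  forall x y, eqv_rel E x y -> eqv_rel F x y.
Proof.
move=> cE /qcompatP[_ h] x y xy; apply: h.
by apply/andP; split; apply/le_qquot/eqv_qquot; rewrite // eqv_symm.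
Qed.

(** The only delicate point is that an inequality [u <= v] of P/E with
    [u F v] is realised by a path inside the [F]-class of [u]: every
    intermediate point lies in P/F between two equivalent points, hence is
    equivalent to them, and [F] is the equivalence of P/F. *)
Lemma qcompat_exchange P E F :
  (qcompat E P && qcompat F (qquot P E)) = (qcompat F P && qcompat E (qmeet P F)).
Proof.
apply/andP/andP => -[c1 c2].
  have EF := qcompat_sub c1 c2.
  case/qcompatP: c1 => E1 E2; case/qcompatP: c2 => F1 F2.
  rewrite qquot_qquot // in F2.
  split; apply/qcompatP; split=> // x y.
  - move/F1; apply: connect_sub => {x y} a b /andP[Fab].
    wlog ab : a b Fab / qle (qquot P E) a b.
      move=> hw /orP[ab|ba]; first by apply: hw => //; rewrite ab.
      by rewrite zigzag_symm; apply: hw; rewrite ?ba //; rewrite eqv_symm.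
    move=> _; have := ab; rewrite qposet_ofE.
    have up := @qquot_mono P E F EF.
    apply: (@connect_between _ _ id) => //; first by move=> z; exists z.
    move=> u v au uv vb.
    have {}au : qle (qquot P E) a u by rewrite qposet_ofE.
    have {}vb : qle (qquot P E) v b by rewrite qposet_ofE.
    case/orP: uv => [uv|/E1]; last first.
      by apply: connect_subrel => x y /andP[/EF xy h]; rewrite /zigzag xy.
    have ba : qle (qquot P F) b a by rewrite eqv_qquot // eqv_symm.
    apply/connect1; rewrite /zigzag uv andbT; apply: F2.
    rewrite /qsim (le_qquot _ uv) (qle_trans (up _ _ vb)) //.
    by rewrite (qle_trans ba) // up.
  - move/E1; apply: connect_subrel => u v /andP[uv h].
    have vu : eqv_rel F v u by rewrite eqv_symm EF.
    by rewrite /zigzag uv !qmeetE vu EF ?andbT.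
  - have down u v : qle (qquot (qmeet P F) E) u v -> qle (qquot P E) u v.
      apply: qquot_min => {u v} u v; last exact: eqv_qquot.
      by rewrite qmeetE => /andP[uv _]; apply: le_qquot.
    by case/andP=> /down xy /down yx; apply: E2; rewrite /qsim xy.
case/qcompatP: c1 => F1 F2; case/qcompatP: c2 => E1 E2.
have EF x y : eqv_rel E x y -> eqv_rel F x y.
  move/E1; apply: (connect_min (@eqv_refl F) (@eqv_trans F)) => {x y} x y.
  by case/andP=> _; rewrite !qmeetE => /orP[/andP[]|/andP[_]] //; rewrite eqv_symm.
have up := @qquot_mono P E F EF.
split; apply/qcompatP; split=> x y.
- move/E1; apply: connect_subrel => u v /andP[uv]; rewrite !qmeetE /zigzag uv.
  by case/orP=> /andP[->]; rewrite ?orbT.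
- have half u v : qle (qquot P E) u v -> qle (qquot P E) v u ->
      qle (qquot (qmeet P F) E) u v.
    move=> uv vu; move: (uv); rewrite !qposet_ofE.
    apply: (@connect_between _ _ id) => //; first by move=> z; exists z.
    move=> a b ua ab bv.
    have {}ua : qle (qquot P E) u a by rewrite qposet_ofE.
    have {}bv : qle (qquot P E) b v by rewrite qposet_ofE.
    apply/connect1 => /=; case/orP: ab => [ab|->]; last by rewrite orbT.
    rewrite qmeetE ab F2 //= /qsim (le_qquot _ ab).
    by rewrite up // (qle_trans bv) // (qle_trans vu).
  by case/andP=> xy yx; apply: E2; rewrite /qsim !half.
- move/F1; apply: connect_subrel => u v /andP[uv h]; rewrite /zigzag uv.
  by case/orP: h => /le_qquot ->; rewrite ?orbT.
by rewrite qquot_qquot //; apply: F2.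
Qed.

End Equivalences.

(** * Cutting along an open set *)

Section Restriction.
Variables (A : finType) (P : qposet A).
Implicit Types (B O : {set A}) (E : eqv A).

Lemma qrestrE B u v : qle (qrestr P B) u v = qle P (val u) (val v).
Proof. by rewrite qposet_ofE. Qed.

Lemma qopenP O : reflect (forall x y, x \in O -> qle P x y -> y \in O) (qopen P O).
Proof.
apply: (iffP forallP) => [h x y xO xy|h x].
  by move/forallP: (h x) => /(_ y); rewrite xO xy.
by apply/forallP => y; apply/implyP => /andP[]; apply: h.
Qed.

(** Open sets and their complements share this property, which is what makes
    quotients commute with restrictions. *)
Definition qconvex B : Prop :=
  forall x y z, x \in B -> y \in B -> qle P x z -> qle P z y -> z \in B.

Lemma open_convex O : qopen P O -> qconvex O.
Proof. by move/qopenP=> h x y z xO _ xz _; apply: h xO xz. Qed.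

Lemma openC_convex O : qopen P O -> qconvex (~: O).
Proof.
move/qopenP=> h x y z _; rewrite !inE => yO _ zy.
by apply: contra yO => zO; apply: h zO zy.
Qed.

End Restriction.

Section RestrictionQuotient.
Variables (A : finType) (P : qposet A).
Implicit Types (B O : {set A}) (E : eqv A).

Definition eqv_restr B E : eqv {x | x \in B} := eqv_pull val E.

Lemma eqv_restrE B E u v : eqv_rel (eqv_restr B E) u v = eqv_rel E (val u) (val v).
Proof. exact: eqv_pullE. Qed.

(** A path of P/E between two points of a convex set stays in that set. *)
Lemma qle_qquot_restr B E u v : qconvex (qquot P E) B ->
  qle (qquot (qrestr P B) (eqv_restr B E)) u v = qle (qquot P E) (val u) (val v).
Proof.
move=> cB; rewrite !qposet_ofE; apply/idP/idP.
  by apply: connect_map => a b /=; rewrite qrestrE eqv_restrE.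
apply: connect_between; [|exact: val_inj|].
  move=> z uz zv; have zB : z \in B.
    by apply: (cB (val u) (val v)); rewrite ?qposet_ofE // (valP u, valP v).
  by exists (Sub z zB).
by move=> a b _ /= ab _; apply/connect1; rewrite /= qrestrE eqv_restrE.
Qed.

Lemma qquot_restr B E : qconvex (qquot P E) B ->
  qquot (qrestr P B) (eqv_restr B E) = qrestr (qquot P E) B.
Proof.
by move=> cB; apply: qposetP => u v; rewrite qle_qquot_restr // qrestrE.
Qed.

Lemma eqv_convex B E x y : qconvex (qquot P E) B -> x \in B -> eqv_rel E x y ->
  y \in B.
Proof.
by move=> cB xB xy; apply: (cB x x); rewrite // eqv_qquot // eqv_symm.
Qed.

Lemma qcompat_restr B E : qconvex (qquot P E) B -> qcompat E P ->
  qcompat (eqv_restr B E) (qrestr P B).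
Proof.
move=> cB /qcompatP[h1 h2]; apply/qcompatP; split=> u v.
  rewrite eqv_restrE => /h1; apply: connect_between; [|exact: val_inj|].
    move=> z /zigzag_sub uz _; have zB := eqv_convex cB (valP u) uz.
    by exists (Sub z zB).
  by move=> a b _ ab _; apply/connect1; rewrite /zigzag !qrestrE eqv_restrE.
by rewrite eqv_restrE /qsim !qle_qquot_restr // => /h2.
Qed.

(** Two equivalent points of P/E are on the same side of an open set of P/E,
    so both conditions of [qcompatP] can be checked on each side. *)
Lemma qcompat_split O E : qopen (qquot P E) O ->
  qcompat E P = qcompat (eqv_restr (~: O) E) (qrestr P (~: O)) &&
                qcompat (eqv_restr O E) (qrestr P O).
Proof.
move=> oO; have cO := open_convex oO; have cC := openC_convex oO.
apply/idP/andP => [c|[c1 c2]]; first by split; apply: qcompat_restr.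
have gen B x y (xB : x \in B) (yB : y \in B) : qconvex (qquot P E) B ->
    qcompat (eqv_restr B E) (qrestr P B) ->
    (eqv_rel E x y -> connect (zigzag P E) x y) /\
    (qsim (qquot P E) x y -> eqv_rel E x y).
  move=> cB /qcompatP[h1 h2].
  pose u : {x | x \in B} := Sub x xB; pose v : {x | x \in B} := Sub y yB.
  move: (h1 u v) (h2 u v); rewrite eqv_restrE /qsim !qle_qquot_restr //.
  move=> {}h1 {}h2; split=> // /h1; apply: (@connect_map _ _ val) => a b.
  by rewrite /zigzag !qrestrE eqv_restrE.
have same x y : qsim (qquot P E) x y -> (x \in O) = (y \in O).
  case/andP=> xy yx; move/qopenP: oO => oO.
  by apply/idP/idP => h; [apply: oO h xy|apply: oO h yx].
have all x y : qsim (qquot P E) x y ->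
    (eqv_rel E x y -> connect (zigzag P E) x y) /\
    (qsim (qquot P E) x y -> eqv_rel E x y).
  move=> xy; have := same x y xy; case: (boolP (x \in O)) => xO => [/esym|/esym/negbT] yO.
    exact: (gen O).
  by apply: (gen (~: O)); rewrite ?inE.
apply/qcompatP; split=> x y xy.
  apply: (proj1 (all x y _)) => //.
  by rewrite /qsim !eqv_qquot // eqv_symm.
exact: (proj2 (all x y xy)).
Qed.

End RestrictionQuotient.

Section Glue.
Variables (A : finType) (O : {set A}).
Variables (E1 : eqv {x | x \in ~: O}) (E2 : eqv {x | x \in O}).

Definition glue_rel : rel A := fun x y =>
  ((x, y) \in [set (val u.1, val u.2) | u in eqv_graph E1]) ||
  ((x, y) \in [set (val u.1, val u.2) | u in eqv_graph E2]).

Lemma glue_out (u v : {x | x \in ~: O}) :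
  glue_rel (val u) (val v) = eqv_rel E1 u v.
Proof.
rewrite /glue_rel orbC; case: imsetP => [[[a b] _ [ua _]]|_] /=.
  by have := valP u; rewrite /= inE ua (valP a).
apply/imsetP/idP => [[[a b] ab [/val_inj -> /val_inj ->]]|uv] //.
by exists (u, v).
Qed.

Lemma glue_in (u v : {x | x \in O}) :
  glue_rel (val u) (val v) = eqv_rel E2 u v.
Proof.
rewrite /glue_rel; case: imsetP => [[[a b] _ [ua _]]|_] /=.
  by have := valP a; rewrite /= inE -ua (valP u).
apply/imsetP/idP => [[[a b] ab [/val_inj -> /val_inj ->]]|uv] //.
by exists (u, v).
Qed.

Lemma glue_same x y : glue_rel x y -> (x \in O) = (y \in O).
Proof.
case/orP=> /imsetP[[[a ha] [b hb]] _ [-> ->]] /=; last by rewrite ha hb.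
by move: ha hb; rewrite !inE => /negbTE-> /negbTE->.
Qed.

Lemma glue_ind (Q : A -> Prop) :
    (forall u : {x | x \in ~: O}, Q (val u)) ->
    (forall u : {x | x \in O}, Q (val u)) ->
  forall x, Q x.
Proof.
move=> h1 h2 x; case: (boolP (x \in O)) => xO; first exact: (h2 (Sub x xO)).
by apply: (h1 (Sub x _)); rewrite inE.
Qed.

Lemma glue_refl : reflexive glue_rel.
Proof.
by apply: glue_ind => u; rewrite ?glue_in ?glue_out eqv_refl.
Qed.

Lemma glue_sym : symmetric glue_rel.
Proof.
suff h x y : glue_rel x y -> glue_rel y x by move=> x y; apply/idP/idP; apply: h.
by case/orP=> /imsetP[[a b] /= ab [-> ->]]; rewrite ?glue_in ?glue_out eqv_symm.
Qed.

Lemma glue_trans : transitive glue_rel.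
Proof.
move=> y x z xy yz; have xyO := glue_same xy; have yzO := glue_same yz.
case: (boolP (x \in O)) => xO.
  have yO : y \in O by rewrite -xyO.
  have zO : z \in O by rewrite -yzO.
  move: xy yz; rewrite -[x]/(val (Sub x xO : {x | x \in O})).
  rewrite -[y]/(val (Sub y yO : {x | x \in O})).
  rewrite -[z]/(val (Sub z zO : {x | x \in O})) !glue_in.
  exact: eqv_trans.
have xC : x \in ~: O by rewrite inE.
have yC : y \in ~: O by rewrite inE -xyO.
have zC : z \in ~: O by rewrite inE -yzO -xyO.
move: xy yz; rewrite -[x]/(val (Sub x xC : {x | x \in ~: O})).
rewrite -[y]/(val (Sub y yC : {x | x \in ~: O})).
rewrite -[z]/(val (Sub z zC : {x | x \in ~: O})) !glue_out.
exact: eqv_trans.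
Qed.

Definition glue : eqv A := eqv_of glue_refl glue_sym glue_trans.

Lemma restr_glue_out : eqv_restr (~: O) glue = E1.
Proof. by apply: eqvP => u v; rewrite eqv_restrE eqv_ofE glue_out. Qed.

Lemma restr_glue_in : eqv_restr O glue = E2.
Proof. by apply: eqvP => u v; rewrite eqv_restrE eqv_ofE glue_in. Qed.

End Glue.

Lemma qopen_qquot (A : finType) (P : qposet A) (O : {set A}) (E : eqv A) :
  reflect (qopen P O /\ forall x y, eqv_rel E x y -> (x \in O) = (y \in O))
          (qopen (qquot P E) O).
Proof.
apply: (iffP idP) => [/qopenP h|[/qopenP h1 h2]].
  split; first by apply/qopenP => x y xO xy; apply: h xO _; apply: le_qquot.
  move=> x y xy; apply/idP/idP => xO; apply: h xO _; apply: eqv_qquot => //.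
  by rewrite eqv_symm.
apply/qopenP => x y xO; rewrite qposet_ofE => xy.
have := @connect_min _ _ (fun x y => (x \in O) ==> (y \in O)) _ _ _ _ _ xy.
rewrite xO; apply=> {x y xO xy}.
- by move=> x; rewrite implybb.
- by move=> y x z /implyP xy /implyP yz; apply/implyP => /xy.
- move=> x y /orP[xy|/h2 ->]; last by rewrite implybb.
  by apply/implyP => xO; apply: h1 xO xy.
Qed.

Lemma qopen_glue (A : finType) (P : qposet A) (O : {set A}) E1 E2 :
  qopen P O -> qopen (qquot P (@glue A O E1 E2)) O.
Proof.
by move=> oO; apply/qopen_qquot; split=> // x y; rewrite eqv_ofE => /glue_same.
Qed.

Lemma glue_restr (A : finType) (P : qposet A) (O : {set A}) E :
  qopen (qquot P E) O -> glue (eqv_restr (~: O) E) (eqv_restr O E) = E.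
Proof.
case/qopen_qquot=> _ sO; apply: eqvP => x y; rewrite eqv_ofE.
apply/idP/idP.
  case/orP=> /imsetP[[u v] uv [-> ->]]; move: uv.
    by rewrite -[_ \in _]/(eqv_rel _ u v) eqv_restrE.
  by rewrite -[_ \in _]/(eqv_rel _ u v) eqv_restrE.
move=> xy; have xyO := sO _ _ xy; case: (boolP (x \in O)) => xO.
  have yO : y \in O by rewrite -xyO.
  have := @glue_in _ O (eqv_restr (~: O) E) (eqv_restr O E) (Sub x xO) (Sub y yO).
  by rewrite eqv_restrE /= => ->.
have xC : x \in ~: O by rewrite inE.
have yC : y \in ~: O by rewrite inE -xyO.
have := @glue_out _ O (eqv_restr (~: O) E) (eqv_restr O E) (Sub x xC) (Sub y yC).
by rewrite eqv_restrE /= => ->.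
Qed.

(** The first bijection: restriction to both sides of [O] and gluing are
    inverse to each other.  It is stated for an arbitrary function of the two
    isoclasses so as to serve for the product, for the coproduct and for
    convolutions of scalar functions. *)
Lemma sum_compat_open (A : finType) (P : qposet A) (O : {set A}) (V : nmodType)
    (G : isoclass -> isoclass -> V) : qopen P O ->
  \sum_(E | qcompat E P && qopen (qquot P E) O)
     G (icl (qrestr (qquot P E) (~: O))) (icl (qrestr (qquot P E) O)) =
  \sum_(E1 | qcompat E1 (qrestr P (~: O))) \sum_(E2 | qcompat E2 (qrestr P O))
     G (icl (qquot (qrestr P (~: O)) E1)) (icl (qquot (qrestr P O) E2)).
Proof.
move=> oO; rewrite pair_big /=.
rewrite (reindex_onto (fun p => glue p.1 p.2)
           (fun E => (eqv_restr (~: O) E, eqv_restr O E))) /=; last first.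
  by move=> E /andP[_]; apply: glue_restr.
have oG E1 E2 := qopen_glue E1 E2 oO.
apply: eq_big => [[E1 E2]|[E1 E2]] /=.
  by rewrite oG (qcompat_split (oG _ _)) restr_glue_out restr_glue_in eqxx !andbT.
move=> _; rewrite -!qquot_restr ?restr_glue_out ?restr_glue_in //.
  exact: open_convex.
exact: openC_convex.
Qed.

Section Isoclasses.
Variable V : nmodType.
Implicit Types (G : isoclass -> isoclass -> V) (A : finType).

Lemma sum_open_irep A (P : qposet A) G :
  \sum_(O | qopen (irep (icl P)) O)
    G (icl (qrestr (irep (icl P)) (~: O))) (icl (qrestr (irep (icl P)) O)) =
  \sum_(O | qopen P O) G (icl (qrestr P (~: O))) (icl (qrestr P O)).
Proof.
case: (irep_icl P) => f [g fK gK] hf.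
rewrite (reindex _ (onW_bij _ (preim_bij fK gK))) /=.
apply: eq_big => O; first by rewrite (qopen_tr gK hf).
move=> _; rewrite -preimsetC.
by rewrite !(proj2 (iclP _ _) (restr_tr fK gK hf _)).
Qed.

Lemma sum_compat_irep A (P : qposet A) (F : isoclass -> V) :
  \sum_(E | qcompat E (irep (icl P))) F (icl (qquot (irep (icl P)) E)) =
  \sum_(E | qcompat E P) F (icl (qquot P E)).
Proof.
case: (irep_icl P) => f [g fK gK] hf.
rewrite (reindex _ (onW_bij _ (eqv_pull_bij fK gK))) /=.
apply: eq_big => E; first by rewrite (qcompat_tr fK gK hf).
move=> _; congr (F _); apply/iclP; exists f; first by exists g.
by move=> x y; rewrite (qquot_tr fK gK hf).
Qed.

(** Compatibility of theta with the coproduct, before linearization. *)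
Lemma sum_quot_open A (P : qposet A) G :
  \sum_(E | qcompat E P) \sum_(O | qopen (qquot P E) O)
     G (icl (qrestr (qquot P E) (~: O))) (icl (qrestr (qquot P E) O)) =
  \sum_(O | qopen P O)
    \sum_(E1 | qcompat E1 (qrestr P (~: O))) \sum_(E2 | qcompat E2 (qrestr P O))
     G (icl (qquot (qrestr P (~: O)) E1)) (icl (qquot (qrestr P O) E2)).
Proof.
rewrite (exchange_big_dep (qopen P)) /=; last by move=> E O _ /qopen_qquot[].
by apply: eq_bigr => O oO; apply: sum_compat_open.
Qed.

End Isoclasses.

Lemma icl_restrT (A : finType) (P : qposet A) (B : {set A}) :
  (forall x, x \in B) -> icl (qrestr P B) = icl P.
Proof.
move=> hB; apply/iclP; exists val; last by move=> x y; rewrite qrestrE.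
by exists (fun x => Sub x (hB x)) => [x|x] //; apply: val_inj.
Qed.

Lemma icl_restr_image (A B : finType) (P : qposet A) (Q : qposet B)
    (O : {set B}) (h : A -> B) : injective h -> (forall y, (y \in O) = (y \in codom h)) ->
  (forall x y, qle P x y = qle Q (h x) (h y)) -> icl (qrestr Q O) = icl P.
Proof.
move=> hi hO hle; apply/iclP/iso_sym.
have hx x : h x \in O by rewrite hO codom_f.
exists (fun x => Sub (h x) (hx x)); last by move=> x y; rewrite qrestrE hle.
have hy (u : {y | y \in O}) : val u \in codom h by rewrite -hO (valP u).
exists (fun u => iinv (hy u)) => [x|u]; last by apply: val_inj; rewrite /= f_iinv.
by apply: hi; rewrite f_iinv.
Qed.

Lemma icl_clopen (A : finType) (P : qposet A) (O : {set A}) :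
  qopen P O -> qopen P (~: O) ->
  icl P = icl (qsum (qrestr P (~: O)) (qrestr P O)).
Proof.
move=> /qopenP oO /qopenP oC; apply/iclP/iso_sym.
exists (fun u : {x | x \in ~: O} + {x | x \in O} =>
  match u with inl x => val x | inr x => val x end).
  apply: inj_card_bij.
    move=> [[x hx]|[x hx]] [[y hy]|[y hy]] /= e; subst y.
    - by congr inl; apply: val_inj.
    - by have := hx; rewrite inE hy.
    - by have := hy; rewrite inE hx.
    - by congr inr; apply: val_inj.
  by rewrite card_sum !card_sig addnC cardsC.
move=> [[x hx]|[x hx]] [[y hy]|[y hy]]; rewrite qposet_ofE /= ?qrestrE //.
  by symmetry; apply/negP => /(oC _ _ hx) h; have := h; rewrite inE hy.
by symmetry; apply/negP => /(oO _ _ hx) h; have := hy; rewrite inE h.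
Qed.

Lemma eqv_void (A : finType) (E F : eqv A) : #|A| = 0%N -> E = F.
Proof. by move=> A0; apply: eqvP => x; have := fintype0 x A0. Qed.

Lemma sum_compat_void (A : finType) (P : qposet A) (V : nmodType)
    (F : isoclass -> V) : #|A| = 0%N ->
  \sum_(E | qcompat E P) F (icl (qquot P E)) = F iempty.
Proof.
move=> A0; rewrite (big_pred1 (eqv_sim P)).
  by rewrite card_iempty.
by move=> E; rewrite (eqv_void E (eqv_sim P) A0) /= qcompat_eqv_sim eqxx.
Qed.

(** * Theta is a morphism of bialgebras *)

Section LinearMaps.
Variable K : fieldType.

HB.instance Definition _ := GRing.Linear.copy (@theta K) (linext (@theta_icl K)).
HB.instance Definition _ :=
  GRing.Linear.copy (@theta_inv K) (linext (@theta_inv_icl K)).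
HB.instance Definition _ := GRing.Linear.copy (@hcoprod K) (linext (@coprod_icl K)).
HB.instance Definition _ :=
  GRing.Linear.copy (@hmul K) (linext (fun cd => << cd.1 >> * << cd.2 >>)).
HB.instance Definition _ f g := GRing.Linear.copy (@tensmap K f g)
  (linext (fun cd => tens (f << cd.1 >>) (g << cd.2 >>))).
HB.instance Definition _ := GRing.Linear.copy (@ehr K)
  (linext (fun c => ehr_poly K (irep c))).
HB.instance Definition _ := GRing.Linear.copy (@ehr_str K)
  (linext (fun c => ehr_str_poly K (irep c))).

Lemma malgUZ (T : choiceType) (a : K) (t : T) :
  << a *g t >> = a *: << t >> :> {malg K[T]}.
Proof. by apply/malgP => u; rewrite mcoeffZ !mcoeffU mulrnAr mulr1. Qed.

Lemma malgE (T : choiceType) (h : {malg K[T]}) :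
  h = \sum_(t <- msupp h) h@_t *: << t >>.
Proof.
by rewrite {1}[h]monalgE; apply: eq_bigr => t _; apply: malgUZ.
Qed.

Lemma linear_ext (T : choiceType) (V : lmodType K) (f g : {malg K[T]} -> V) :
  linear f -> linear g -> (forall t, f << t >> = g << t >>) -> f =1 g.
Proof.
move=> lf lg e h.
pose f' : {linear _ -> _} := HB.pack f (GRing.isLinear.Build _ _ _ _ f lf).
pose g' : {linear _ -> _} := HB.pack g (GRing.isLinear.Build _ _ _ _ g lg).
rewrite -[f h]/(f' h) -[g h]/(g' h) (malgE h) !linear_sum.
by apply: eq_bigr => t _; rewrite !linearZ; congr (_ *: _); apply: e.
Qed.

Lemma linear_icl_ext (V : lmodType K) (f g : Hqp K -> V) :
    linear f -> linear g ->
    (forall (A : finType) (P : qposet A), f << icl P >> = g << icl P >>) ->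
  f =1 g.
Proof.
by move=> lf lg e; apply: linear_ext => // c; rewrite -(icl_irep c).
Qed.

Lemma tensE (u v : Hqp K) :
  tens u v = linext (fun c => linext (fun d => << (c, d) >> : Hqp2 K) v) u.
Proof.
apply: eq_bigr => c _; rewrite scaler_sumr; apply: eq_bigr => d _.
by rewrite malgUZ scalerA.
Qed.

Lemma tens_sum (I J : finType) (p : pred I) (q : pred J) (c : I -> isoclass)
    (d : J -> isoclass) :
  tens (\sum_(i | p i) << c i >>) (\sum_(j | q j) << d j >>) =
  \sum_(i | p i) \sum_(j | q j) << (c i, d j) >> :> Hqp2 K.
Proof.
rewrite tensE linear_sum; apply: eq_bigr => i _.
by rewrite /= linextU linear_sum; apply: eq_bigr => j _; rewrite /= linextU.
Qed.

(** An equivalence compatible with a disjoint union has connected classes, so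
    it does not mix the two summands: one summand is clopen in every quotient,
    and [sum_compat_open] applies to it. *)
Lemma theta_mulUU (A B : finType) (P : qposet A) (Q : qposet B) :
  theta (<< icl P >> * << icl Q >>) = theta << icl P >> * theta << icl Q >> :> Hqp K.
Proof.
pose R := qsum P Q; pose O : {set A + B} := [set u | if u is inr _ then true else false].
have oO : qopen R O by apply/qopenP => -[x|x] [y|y]; rewrite !inE ?qposet_ofE.
have oC : qopen R (~: O) by apply/qopenP => -[x|x] [y|y]; rewrite !inE ?qposet_ofE.
have sepO E : qcompat E R -> forall x y, eqv_rel E x y -> (x \in O) = (y \in O).
  case/qcompatP=> h _ x y /h.
  apply: closed_connect => {x y} x y /andP[_].
  by case: x => x; case: y => y; rewrite !inE ?qposet_ofE.
have icl1 : icl (qrestr R (~: O)) = icl P.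
  apply: (@icl_restr_image _ _ _ _ _ inl) => [x y []|u|x y] //.
    rewrite !inE; case: u => x; first by rewrite codom_f.
    by apply/esym/negbTE/negP => /codomP[].
  by rewrite qposet_ofE.
have icl2 : icl (qrestr R O) = icl Q.
  apply: (@icl_restr_image _ _ _ _ _ inr) => [x y []|u|x y] //.
    rewrite !inE; case: u => x; last by rewrite codom_f.
    by apply/esym/negbTE/negP => /codomP[].
  by rewrite qposet_ofE.
have e1 := thetaE K (qrestr R (~: O)); have e2 := thetaE K (qrestr R O).
rewrite icl1 in e1; rewrite icl2 in e2.
rewrite iclM; apply: etrans (thetaE K R) _; apply: etrans (esym (congr2 *%R e1 e2)).
rewrite big_distrlr /=.
rewrite -(sum_compat_open (fun c d => << c >> * << d >>) oO).
apply: eq_big => E.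
  case cE: (qcompat E R) => //=; apply/esym/qopen_qquot.
  by split=> //; apply: sepO.
move=> cE; have sE := sepO E cE; rewrite iclM -icl_clopen //.
  by apply/qopen_qquot.
by apply/qopen_qquot; split=> // x y /sE; rewrite !inE => ->.
Qed.

Lemma theta1 : theta 1 = 1 :> Hqp K.
Proof.
rewrite -[1]/(<< iempty >> : Hqp K) thetaE.
by rewrite (sum_compat_void _ (fun c => << c >>)) // card_void.
Qed.

Lemma thetaM : {morph @theta K : g h / g * h}.
Proof.
move=> g h; move: g.
have l1 h' : linear (fun g => theta (g * h') : Hqp K).
  by move=> a u v; rewrite mulrDl -scalerAl linearP.
have l2 h' : linear (fun g => theta g * h' : Hqp K).
  by move=> a u v; rewrite linearP mulrDl -scalerAl.
apply: (linear_icl_ext (l1 h) (l2 (theta h))) => A P.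
rewrite mulrC [RHS]mulrC; move: h.
apply: (linear_icl_ext (l1 _) (l2 _)) => B Q.
exact: theta_mulUU.
Qed.

Lemma tensmapU (f g : Hqp K -> Hqp K) c d :
  tensmap f g << (c, d) >> = tens (f << c >>) (g << d >>).
Proof. exact: linextU. Qed.

Lemma theta_coprod (h : Hqp K) :
  hcoprod (theta h) = tensmap (@theta K) (@theta K) (hcoprod h).
Proof.
move: h; apply: linear_icl_ext => [a u v|a u v|A P]; rewrite ?linearP //.
rewrite thetaE linear_sum hcoprodE linear_sum /=.
under eq_bigr do rewrite hcoprodE.
rewrite (sum_quot_open P (fun c d => << (c, d) >>)).
apply: eq_bigr => O _; rewrite tensmapU.
apply: esym; apply: etrans (congr2 (@tens K) (thetaE _ _) (thetaE _ _)) _.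
by rewrite tens_sum.
Qed.

Lemma theta_counit (h : Hqp K) : hcounit (theta h) = hcounit h.
Proof.
move: h; apply: (@linear_icl_ext K^o) => [a u v|a u v|A P].
- by rewrite /hcounit linearP mcoeffD mcoeffZ.
- by rewrite /hcounit mcoeffD mcoeffZ.
rewrite thetaE /hcounit raddf_sum /=.
have [A0|A0] := eqVneq #|A| 0%N.
  apply: etrans (sum_compat_void P (fun c => << c >>@_iempty : K) A0) _.
  by rewrite (card_iempty P A0).
have ne Q : (icl (Q : qposet A) == iempty) = false.
  by apply/negbTE; apply: contra A0 => /eqP/iempty_card ->.
by rewrite big1 => [|E _]; rewrite mcoeffU ne.
Qed.

End LinearMaps.

(** * Convolution of functions on isoclasses *)

Section Convolution.
Variable V : nzRingType.
Implicit Types (f g u : isoclass -> V).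

Definition conv f g (c : isoclass) : V :=
  \sum_(O | qopen (irep c) O)
    f (icl (qrestr (irep c) (~: O))) * g (icl (qrestr (irep c) O)).

(** The composite of theta with the linear extension of [f]. *)
Definition theta_pull f (c : isoclass) : V :=
  \sum_(E | qcompat E (irep c)) f (icl (qquot (irep c) E)).

Lemma convE f g (A : finType) (P : qposet A) :
  conv f g (icl P) =
  \sum_(O | qopen P O) f (icl (qrestr P (~: O))) * g (icl (qrestr P O)).
Proof. exact: (sum_open_irep P (fun c d => f c * g d)). Qed.

Lemma theta_pullE f (A : finType) (P : qposet A) :
  theta_pull f (icl P) = \sum_(E | qcompat E P) f (icl (qquot P E)).
Proof. exact: sum_compat_irep. Qed.

Lemma conv_theta_pull f g (A : finType) (P : qposet A) :
  conv (theta_pull f) (theta_pull g) (icl P) = theta_pull (conv f g) (icl P).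
Proof.
rewrite convE theta_pullE.
under [RHS]eq_bigr do rewrite convE.
rewrite (sum_quot_open P (fun c d => f c * g d)); apply: eq_bigr => O _.
by rewrite !theta_pullE big_distrlr.
Qed.

Lemma qopen0 (A : finType) (P : qposet A) : qopen P set0.
Proof. by apply/qopenP => x y; rewrite inE. Qed.

(** The term of the empty open set is [f P * u iempty], and all other terms
    involve [f] on quasi-posets with fewer points only. *)
Lemma conv_inj u f g : u iempty = 1 -> conv f u =1 conv g u -> f =1 g.
Proof.
move=> u1 e c; rewrite -(icl_irep c).
suff gen n (A : finType) (P : qposet A) : (#|A| < n)%N -> f (icl P) = g (icl P).
  exact: gen (ltnSn _).
elim: n A P => // n IH A P; rewrite ltnS => le.
have := e (icl P); rewrite !convE.
rewrite (bigD1 set0) ?qopen0 //= [in RHS](bigD1 set0) ?qopen0 //=.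
rewrite (icl_restrT P (B := ~: set0)) => [|x]; last by rewrite !inE.
rewrite (card_iempty (qrestr P set0)) ?card_sig ?cards0 // u1 !mulr1.
rewrite [X in _ + X = _](eq_bigr (fun O =>
  g (icl (qrestr P (~: O))) * u (icl (qrestr P O)))); first by move/addIr.
move=> O /andP[_ O0]; rewrite IH // card_sig.
apply: leq_trans le; rewrite -[X in (_ < X)%N](cardsC O).
by rewrite -[X in (X < _)%N]add0n ltn_add2r card_gt0.
Qed.

End Convolution.

(** * The signed count of compatible equivalences *)

Section Signs.
Variable A : finType.
Implicit Types (P : qposet A) (B O : {set A}).

Definition qsymm (B : finType) (Q : qposet B) : bool :=
  [forall x, forall y, qle Q x y ==> qle Q y x].

Lemma qsymmP (B : finType) (Q : qposet B) :
  reflect (forall x y, qle Q x y -> qle Q y x) (qsymm Q).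
Proof.
apply: (iffP forallP) => h x; last by apply/forallP => y; apply/implyP/h.
by move=> y; move/forallP: (h x) => /(_ y)/implyP.
Qed.

Lemma qsymm_restrP P B :
  reflect (forall x y, x \in B -> y \in B -> qle P x y -> qle P y x)
          (qsymm (qrestr P B)).
Proof.
apply: (iffP (qsymmP _)) => [h x y xB yB|h u v].
  by move: (h (Sub x xB) (Sub y yB)); rewrite !qrestrE.
by rewrite !qrestrE; apply: h; apply: valP.
Qed.

Definition sim_class P m : {set A} := [set y | qsim P m y].

Lemma ncl_restr P B :
  ncl (qsim (qrestr P B)) = #|equivalence_partition (qsim P) B|.
Proof.
pose h (S : {set {x | x \in B}}) : {set A} := val @: S.
have hi : injective h by apply: imset_inj; apply: val_inj.
have hcl u : h [set v in setT | qsim (qrestr P B) u v] =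
    [set y in B | qsim P (val u) y].
  apply/setP => y; apply/imsetP/idP => [[v]|]; rewrite !inE.
    by move=> uv ->; rewrite (valP v) /=; move: uv; rewrite /qsim !qrestrE.
  by case/andP=> yB uy; exists (Sub y yB); rewrite // !inE /qsim !qrestrE.
rewrite /ncl -(card_imset _ hi); congr #|pred_of_set _|.
apply/setP => S; apply/imsetP/imsetP => [[_ /imsetP[u _ ->] ->]|[x xB ->]].
  by exists (val u); rewrite ?hcl //; apply: valP.
exists [set v in setT | qsim (qrestr P B) (Sub x xB) v]; last by rewrite hcl.
by apply/imsetP; exists (Sub x xB).
Qed.

Lemma ncl_restr_class P m B : [disjoint sim_class P m & B] ->
  ncl (qsim (qrestr P (sim_class P m :|: B))) = (ncl (qsim (qrestr P B))).+1.
Proof.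
move=> dis; rewrite !ncl_restr.
set C := sim_class P m; have mC : m \in C by rewrite inE qsim_refl.
have nB x : x \in C -> x \notin B by move=> xC; rewrite (disjointFr dis).
have nC x : x \in B -> x \notin C by move=> xB; rewrite (disjointFl dis).
have clB x : x \in B ->
    [set y in C :|: B | qsim P x y] = [set y in B | qsim P x y].
  move=> xB; apply/setP => y; rewrite !inE; case xy: (qsim P x y); rewrite ?andbF //.
  rewrite !andbT; case my: (qsim P m y) => //=.
  by have := nC x xB; rewrite inE (qsim_trans my) // qsim_symm.
have clC x : x \in C -> [set y in C :|: B | qsim P x y] = C.
  rewrite inE => mx; apply/setP => y; rewrite !inE.
  apply/andP/idP => [[_ xy]|my]; first exact: qsim_trans mx xy.
  by rewrite my (qsim_trans _ my) // qsim_symm.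
have -> : equivalence_partition (qsim P) (C :|: B) =
    C |: equivalence_partition (qsim P) B.
  apply/setP => S; rewrite in_setU1; apply/imsetP/orP => [[x]|].
    rewrite inE => /orP[xC|xB] ->; first by left; rewrite clC.
    by right; rewrite clB //; apply/imsetP; exists x.
  case=> [/eqP ->|/imsetP[x xB ->]].
    by exists m; rewrite ?clC // inE mC.
  by exists x; rewrite ?clB // inE xB orbT.
rewrite cardsU1; case: imsetP => // -[x _ CE].
by have := nB m mC; move: (mC); rewrite {1}CE inE => /andP[->].
Qed.

Lemma exists_maximal P (x0 : A) : exists m, forall y, qle P m y -> qle P y m.
Proof.
pose up x := [set y | qle P x y].
case: (arg_minnP (fun x => #|up x|) (isT : xpredT x0)) => m _ hm.
exists m => y my; have sub : up y \subset up m.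
  by apply/subsetP => z; rewrite !inE; apply: qle_trans.
have /eqP e : up y == up m by rewrite eqEcard sub hm.
have : m \in up m by rewrite inE qle_refl.
by rewrite -e inE.
Qed.

(** Let C be the class of a maximal element.  Adding C to an open set on which
    [P] is symmetric, or removing C from it, yields a set of the same kind;
    since [s] changes sign, the terms cancel in pairs. *)
Lemma sum_symm_open P (x0 : A) (V : zmodType) (s : {set A} -> V) :
    (forall m O, [disjoint sim_class P m & O] -> s (sim_class P m :|: O) = - s O) ->
  \sum_(O | qopen P O && qsymm (qrestr P O)) s O = 0.
Proof.
move=> hs; have [m hm] := exists_maximal P x0; set C := sim_class P m.
have mC : m \in C by rewrite inE qsim_refl.
pose Q O := qopen P O && qsymm (qrestr P O).
have CO O : qopen P O -> m \in O -> C \subset O.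
  by move/qopenP=> h mO; apply/subsetP => y; rewrite inE => /andP[/(h _ _ mO)].
have dis O : qopen P O -> m \notin O -> [disjoint C & O].
  move/qopenP=> h; rewrite disjoint_subset; apply: contraR => /subsetPn[y].
  rewrite !inE => /andP[_ ym]; rewrite negbK => yO; exact: h yO ym.
have QU O : Q O -> Q (C :|: O).
  case/andP=> /qopenP oO /qsymm_restrP sO.
  have Cmax x y : x \in C -> qle P x y -> qle P y x.
    rewrite inE => /andP[mx _] xy.
    exact: qle_trans (hm _ (qle_trans mx xy)) mx.
  apply/andP; split.
    apply/qopenP => x y; rewrite !inE => /orP[xC|xO] xy.
      apply/orP; left; apply: (qsim_trans xC).
      by rewrite /qsim xy Cmax // inE.
    by rewrite (oO x) ?orbT.
  apply/qsymm_restrP => x y; rewrite !in_setU => /orP[xC|xO] _ xy.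
    exact: Cmax.
  exact: sO (oO _ _ xO xy) xy.
have QD O : Q O -> Q (O :\: C).
  case/andP=> /qopenP oO /qsymm_restrP sO; apply/andP; split.
    apply/qopenP => x y; rewrite !in_setD => /andP[xC xO] xy.
    have yO := oO _ _ xO xy; rewrite yO andbT.
    apply: contra xC; rewrite !inE => my; apply: (qsim_trans my).
    by rewrite /qsim xy sO.
  by apply/qsymm_restrP => x y /setDP[xO _] /setDP[yO _]; apply: sO.
rewrite -/(Q _) (bigID (fun O : {set A} => m \in O)) /=.
rewrite (reindex_onto (fun O => C :|: O) (fun O => O :\: C)) /=; last first.
  by move=> O /andP[/andP[oO _] /(CO _ oO)] /setIidPr e; rewrite -[RHS](setID O C) e.
apply/eqP; rewrite addr_eq0 -sumrN; apply/eqP.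
apply: eq_big => O.
  rewrite in_setU mC orTb andbT; apply/andP/andP => [[QO /eqP <-]|[QO mO]].
    by split; [apply: QD|rewrite in_setD mC].
  split; first exact: QU.
  rewrite setDUl setDv set0U; apply/eqP/setDidPl.
  by rewrite disjoint_sym dis //; case/andP: QO.
case/andP=> _ /eqP <-; apply: hs.
by rewrite disjoint_sym disjoints_subset subsetDr.
Qed.

End Signs.

Section EulerCharacteristic.

Lemma qsymm_iso (A B : finType) (P : qposet A) (Q : qposet B) :
  isomorphic P Q -> qsymm P = qsymm Q.
Proof.
move=> h; suff imp C D (R : qposet C) (S : qposet D) :
    isomorphic R S -> qsymm R -> qsymm S.
  by apply/idP/idP; apply: imp => //; apply: iso_sym.
case=> f [g fK gK] hf /qsymmP sR; apply/qsymmP => x y.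
by rewrite -(gK x) -(gK y) -!hf; apply: sR.
Qed.

Definition sgn_icl (c : isoclass) : int := (-1) ^+ ncl (qsim (irep c)).

Definition symm_icl (c : isoclass) : int := (qsymm (irep c))%:R.

Lemma sgn_iclE (A : finType) (P : qposet A) :
  sgn_icl (icl P) = (-1) ^+ ncl (qsim P).
Proof.
case: (irep_icl P) => f [g fK gK] hf.
by rewrite /sgn_icl (ncl_tr fK gK (qsim_tr hf)).
Qed.

Lemma symm_iclE (A : finType) (P : qposet A) : symm_icl (icl P) = (qsymm P)%:R.
Proof. by rewrite /symm_icl (qsymm_iso (irep_icl P)). Qed.

Lemma symm_iempty : symm_icl iempty = 1.
Proof. by rewrite symm_iclE; have -> : qsymm qvoid by apply/qsymmP => -[]. Qed.

Definition one_icl (c : isoclass) : int := 1.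

Lemma conv_void (V : nzRingType) (f g : isoclass -> V) (A : finType)
    (P : qposet A) : #|A| = 0%N -> conv f g (icl P) = f iempty * g iempty.
Proof.
move=> A0; rewrite convE (big_pred1 set0).
  by rewrite !card_iempty // card_sig; apply/eqP; rewrite -leqn0 -A0 max_card.
move=> O /=; have -> : O = set0 by apply/setP => x; have := fintype0 x A0.
by rewrite qopen0 eqxx.
Qed.

(** Here the sign is that of the complement of the open set, from which a
    maximal class is moved to the open set or back. *)
Lemma conv_sgn_symm (A : finType) (P : qposet A) (x0 : A) :
  conv sgn_icl symm_icl (icl P) = 0.
Proof.
rewrite convE -[RHS](@sum_symm_open _ P x0 _ (fun O => sgn_icl (icl (qrestr P (~: O))))).
  rewrite big_mkcondr; apply: eq_bigr => O _; rewrite symm_iclE.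
  by case: ifP; rewrite (mulr1, mulr0).
move=> m O dis; rewrite !sgn_iclE.
have -> : ~: O = sim_class P m :|: ~: (sim_class P m :|: O).
  by rewrite setCU setUIr setUCr setTI; apply/esym/setUidPr; rewrite -disjoints_subset.
rewrite ncl_restr_class ?exprS ?mulN1r ?opprK //.
by rewrite disjoints_subset setCK subsetUl.
Qed.

Definition qop (A : finType) (P : qposet A) : qposet A :=
  @qposet_of A (fun x y => qle P y x) (@qle_refl A P)
    (fun y x z xy yz => qle_trans yz xy).

(** The complements of the open sets of [P] are the open sets of the opposite
    quasi-order, and a maximal class of the latter is toggled. *)
Lemma conv_sgn_symm_one (A : finType) (P : qposet A) (x0 : A) :
  conv (fun c => sgn_icl c * symm_icl c) one_icl (icl P) = 0.
Proof.
rewrite convE (reindex_inj (@setC_inj A)) /=.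
rewrite -[RHS](@sum_symm_open _ (qop P) x0 _ (fun O => sgn_icl (icl (qrestr P O)))).
  rewrite [RHS]big_mkcondr; apply: eq_big => [O|O _].
    apply/qopenP/qopenP => h x y; rewrite ?qposet_ofE => xO xy.
      by apply: contraLR xO => yO; rewrite -in_setC; apply: h xy; rewrite inE.
    rewrite inE; rewrite inE in xO; apply: contra xO => yO.
    by apply: h yO _; rewrite qposet_ofE.
  rewrite setCK mulr1 symm_iclE.
  have -> : qsymm (qrestr (qop P) O) = qsymm (qrestr P O).
    apply/qsymm_restrP/qsymm_restrP => h x y xO yO.
      by move: (h y x yO xO); rewrite !qposet_ofE.
    by rewrite !qposet_ofE; apply: h.
  by case: ifP; rewrite (mulr1, mulr0).
move=> m O; have -> : sim_class (qop P) m = sim_class P m.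
  by apply/setP => y; rewrite !inE /qsim !qposet_ofE andbC.
by move=> dis; rewrite !sgn_iclE ncl_restr_class // exprS mulN1r.
Qed.

(** P/E is symmetric for exactly one compatible [E], whose classes are the
    connected components of [P]. *)
Lemma theta_pull_symm (A : finType) (P : qposet A) :
  theta_pull symm_icl (icl P) = 1.
Proof.
rewrite theta_pullE.
pose r : rel A := fun x y => qle P x y || qle P y x.
have rs : connect_sym r by apply: sym_connect_sym => x y; rewrite /r orbC.
pose E0 := eqv_of (@connect0 _ r) rs (@connect_trans _ r).
have E0E : eqv_rel E0 =2 connect r by apply: eqv_ofE.
rewrite (eq_bigr (fun E => if qsymm (qquot P E) then 1 else 0)) => [|E _]; last first.
  by rewrite symm_iclE; case: ifP.
rewrite -big_mkcondr (big_pred1 E0) // => E /=; apply/andP/eqP => [[cE /qsymmP sE]|->].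
  have sub x y : qle P x y -> eqv_rel E x y.
    move=> xy; rewrite -(qcompat_sim cE) /qsim.
    by have := le_qquot E xy; move=> h; rewrite h sE.
  case/qcompatP: cE => h1 _; apply: eqvP => x y; rewrite E0E; apply/idP/idP.
    by move/h1; apply: connect_subrel => u v /andP[].
  apply: (connect_min (@eqv_refl _ E) (@eqv_trans _ E)) => {x y} x y.
  by case/orP=> /sub //; rewrite eqv_symm.
have leE x y : qle (qquot P E0) x y -> connect r x y.
  rewrite qposet_ofE; apply: connect_sub => {x y} x y; rewrite /= E0E.
  by case/orP=> // xy; apply/connect1; rewrite /r xy.
split; last first.
  by apply/qsymmP => x y /leE; rewrite rs -E0E; apply: eqv_qquot.
apply/qcompatP; split=> x y; last by case/andP=> /leE; rewrite E0E.
rewrite E0E; apply: connect_sub => {x y} x y xy; apply/connect1.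
by rewrite /zigzag E0E connect1.
Qed.

(** Both sides have the same convolution with the constant 1, which is the
    image under [theta_pull] of the indicator of symmetric quasi-orders. *)
Lemma theta_pull_sgn : theta_pull sgn_icl =1 (fun c => sgn_icl c * symm_icl c).
Proof.
apply: (@conv_inj _ one_icl) => // c; rewrite -(icl_irep c).
move: (irep c); set A := 'I_ _ => P.
have <- : conv (theta_pull sgn_icl) (theta_pull symm_icl) (icl P) =
    conv (theta_pull sgn_icl) one_icl (icl P).
  by rewrite !convE; apply: eq_bigr => O _; rewrite theta_pull_symm.
rewrite conv_theta_pull theta_pullE.
have [A0|] := eqVneq #|A| 0%N.
  rewrite (sum_compat_void _ _ A0) (conv_void _ _ P A0).
  by rewrite (conv_void _ _ qvoid card_void) symm_iempty /one_icl !mulr1.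
rewrite -lt0n => /card_gt0P[x0 _]; rewrite (conv_sgn_symm_one P x0).
by rewrite big1 // => E _; apply: conv_sgn_symm.
Qed.

(** Geometrically, the [E <| P] index the faces of the cone of monotone real
    functions on [P], with cl(E) the dimension: a closed polyhedral cone has
    Euler characteristic 0 unless it is a linear space. *)
Lemma sum_compat_sgn (R : pzRingType) (A : finType) (P : qposet A) :
  \sum_(E | qcompat E P) (-1) ^+ ncl (eqv_rel E) =
  (if qsymm P then (-1) ^+ ncl (qsim P) else 0) :> R.
Proof.
have := theta_pull_sgn (icl P); rewrite theta_pullE sgn_iclE symm_iclE.
move/(congr1 (fun a : int => a%:~R : R)).
rewrite rmorph_sum rmorphM rmorphXn rmorphN1 /= => h.
rewrite -[RHS]mulrb -mulr_natr.
apply: etrans (etrans _ h) _; last by rewrite rmorph_nat.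
apply: eq_bigr => E cE; rewrite sgn_iclE rmorphXn rmorphN1.
by rewrite (eq_ncl (qcompat_sim cE)).
Qed.

End EulerCharacteristic.

(** * The inverse of theta and the antipode *)

Section MoebiusSum.
Variables (K : fieldType) (A : finType) (P : qposet A).

Lemma qsymm_qmeet (F : eqv A) : qcompat F P ->
  qsymm (qmeet P F) = (F == eqv_sim P).
Proof.
move=> cF; apply/qsymmP/eqP => [h|-> x y].
  apply: eqvP => x y; rewrite eqv_simE; apply/idP/idP.
    case/qcompatP: cF => h1 _ /h1.
    apply: (connect_min (@qsim_refl _ P) (@qsim_trans _ P)) => {x y} x y.
    case/andP=> xy; have yx : eqv_rel F y x by rewrite eqv_symm.
    have {}h u v : eqv_rel F u v -> qle P u v -> qsim P u v.
      move=> Fuv uv; have := h u v; rewrite !qmeetE Fuv uv /qsim uv.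
      by move/(_ isT)/andP=> [].
    by case/orP; [apply: h | rewrite qsim_symm; apply: h].
  rewrite -(qcompat_sim cF) => /andP[xy yx].
  by rewrite /qsim !le_qquot.
by rewrite !qmeetE !eqv_simE /qsim => /and3P[-> _ ->]; rewrite andbT.
Qed.

Lemma sum_compat_exchange (V : nmodType) (G : eqv A -> eqv A -> V) :
  \sum_(E | qcompat E P) \sum_(F | qcompat F (qquot P E)) G E F =
  \sum_(F | qcompat F P) \sum_(E | qcompat E (qmeet P F)) G E F.
Proof.
rewrite (exchange_big_dep (fun F => qcompat F P)) /=; last first.
  by move=> E F cE cF; have := qcompat_exchange P E F; rewrite cE cF => /esym/andP[].
apply: eq_bigr => F cF; apply: eq_bigl => E.
by rewrite qcompat_exchange cF.
Qed.

(** After the exchange, the coefficient of [g F] is the signed count for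
    P /\ F, which vanishes unless [F] is the equivalence of [P]. *)
Lemma sum_compat_moebius (V : lmodType K) (g : eqv A -> V) :
  \sum_(E | qcompat E P) \sum_(F | qcompat F (qquot P E))
     (-1) ^+ ncl (eqv_rel E) *: g F =
  (-1) ^+ ncl (qsim P) *: g (eqv_sim P).
Proof.
rewrite sum_compat_exchange (bigD1 (eqv_sim P)) ?qcompat_eqv_sim //=.
rewrite -scaler_suml sum_compat_sgn qsymm_qmeet ?qcompat_eqv_sim // eqxx.
rewrite [X in _ + X]big1 => [|F /andP[cF nF]]; last first.
  by rewrite -scaler_suml sum_compat_sgn qsymm_qmeet // (negbTE nF) scale0r.
rewrite addr0; congr (_ ^+ _ *: _); apply: eq_ncl => x y.
by rewrite /qsim !qmeetE !eqv_simE /qsim; do 2!case: (qle P _ _).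
Qed.

End MoebiusSum.

Section Inverse.
Variable K : fieldType.

Lemma thetaK : cancel (@theta K) (@theta_inv K).
Proof.
apply: linear_icl_ext => [a u v|a u v|A P]; rewrite ?linearP //.
rewrite thetaE linear_sum /=.
have e E : qcompat E P -> theta_inv << icl (qquot P E) >> =
    \sum_(F | qcompat F (qquot P E)) (-1) ^+ ncl (eqv_rel E) *:
      ((-1) ^+ ncl (eqv_rel F) *: << icl (qquot P F) >>) :> Hqp K.
  move=> cE; apply: etrans (theta_invE _ _) _; apply: eq_bigr => F cF.
  rewrite (qquot_qquot P (qcompat_sub cE cF)) (eq_ncl (qcompat_sim cE)).
  by rewrite scalerA -exprD addnC.
rewrite (eq_bigr _ e) sum_compat_moebius (eq_ncl (eqv_simE P)) qquot_sim.
by rewrite scalerA -exprD addnn -signr_odd odd_double scale1r.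
Qed.

Lemma theta_invK : cancel (@theta_inv K) (@theta K).
Proof.
apply: linear_icl_ext => [a u v|a u v|A P]; rewrite ?linearP //.
rewrite theta_invE linear_sum /=.
have e E : qcompat E P ->
    theta ((-1) ^+ (ncl (eqv_rel E) + ncl (qsim P)) *: << icl (qquot P E) >>) =
    (-1) ^+ ncl (qsim P) *: \sum_(F | qcompat F (qquot P E))
      (-1) ^+ ncl (eqv_rel E) *: << icl (qquot P F) >> :> Hqp K.
  move=> cE; rewrite linearZ /=; apply: etrans (congr1 _ (thetaE _ _)) _.
  rewrite addnC exprD -scalerA; congr (_ *: _); rewrite scaler_sumr.
  apply: eq_bigr => F cF.
  by rewrite (qquot_qquot P (qcompat_sub cE cF)).
rewrite (eq_bigr _ e) -scaler_sumr.
rewrite (sum_compat_moebius P (fun F => << icl (qquot P F) >> : Hqp K)) qquot_sim.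
by rewrite scalerA -exprD addnn -signr_odd odd_double scale1r.
Qed.

Lemma tens_linear_ext (V : lmodType K) (phi : {linear Hqp2 K -> V})
    (psi : Hqp K -> Hqp K -> V) :
    (forall v, linear (psi^~ v)) -> (forall u, linear (psi u)) ->
    (forall c d, phi << (c, d) >> = psi << c >> << d >>) ->
  forall u v, phi (tens u v) = psi u v.
Proof.
move=> l1 l2 e u v; move: u.
apply: (@linear_ext _ _ _ (fun u => phi (tens u v)) (psi^~ v)) => // [a u u'|c].
  by rewrite !tensE !linearP.
have tE w : tens << c >> w = linext (fun d => << (c, d) >> : Hqp2 K) w.
  by rewrite tensE linextU.
move: v.
apply: (@linear_ext _ _ _ (fun v => phi (tens << c >> v)) (psi << c >>)) => // [a v v'|d].
  by rewrite !tE !linearP.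
by rewrite tE linextU.
Qed.

Lemma hmul_tens (u v : Hqp K) : hmul (tens u v) = u * v.
Proof.
apply: (@tens_linear_ext _ (@hmul K) *%R) => [w a x y|w a x y|c d].
- by rewrite mulrDl scalerAl.
- by rewrite mulrDr scalerAr.
- exact: linextU.
Qed.

Lemma hmul_tensmap (f g : Hqp K -> Hqp K) u v : linear f -> linear g ->
  hmul (tensmap f g (tens u v)) = f u * g v.
Proof.
move=> lf lg.
apply: (@tens_linear_ext _ (@hmul K \o tensmap f g) (fun u v => f u * g v))
  => [w a x y|w a x y|c d].
- by rewrite lf mulrDl scalerAl.
- by rewrite lg mulrDr scalerAr.
- by rewrite /= tensmapU hmul_tens.
Qed.

Lemma hmul_coprod (f g : Hqp K -> Hqp K) (A : finType) (P : qposet A) :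
    linear f -> linear g ->
  hmul (tensmap f g (hcoprod << icl P >>)) =
  \sum_(O | qopen P O) f << icl (qrestr P (~: O)) >> * g << icl (qrestr P O) >>.
Proof.
move=> lf lg; rewrite hcoprodE (linear_sum (tensmap f g)) (linear_sum (@hmul K)).
by apply: eq_bigr => O _; rewrite /= tensmapU hmul_tens.
Qed.

(** Convolved with theta on the right, both sides give the unit of the
    convolution product: the left one because theta is an algebra morphism,
    the right one because it is a coalgebra morphism. *)
Lemma theta_antipode (S : Hqp K -> Hqp K) : is_antipode S ->
  forall h, theta (S h) = S (theta h).
Proof.
case=> lS hS _; have lid : linear (id : Hqp K -> Hqp K) by [].
apply: linear_ext => [a u v|a u v|].
- by rewrite lS linearP.
- by rewrite linearP lS.
apply: (@conv_inj _ (fun c => theta << c >>)) => [|c]; first exact: theta1.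
rewrite -(icl_irep c); move: (irep c); set A := 'I_ _ => P.
transitivity ((hcounit << icl P >>)%:A : Hqp K).
  (* The unit on the right is written as [theta 1], to pull theta out. *)
  rewrite convE -[in RHS]theta1 -linearZ -hS hmul_coprod // linear_sum.
  by apply: eq_bigr => O _; rewrite /= thetaM.
rewrite -theta_counit -hS theta_coprod convE hcoprodE.
pose phi : {linear Hqp2 K -> Hqp K} :=
  (@hmul K) \o tensmap S id \o tensmap (@theta K) (@theta K).
apply: etrans (linear_sum phi _ _ _) _.
by apply: eq_bigr => O _; rewrite /= tensmapU hmul_tensmap.
Qed.

End Inverse.

(** * Ehrhart polynomials *)

Section EhrhartCounting.
Variables (A : finType) (P : qposet A) (k : nat).
Implicit Types (f : {ffun A -> 'I_k}) (E : eqv A).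

Lemma qLP (Q : qposet A) f :
  reflect (forall x y, qle Q x y -> (f x <= f y)%N) (f \in qL Q k).
Proof.
rewrite inE; apply: (iffP forallP) => [h x y|h x].
  by move/forallP: (h x) => /(_ y)/implyP.
by apply/forallP => y; apply/implyP/h.
Qed.

Lemma qLstrP (Q : qposet A) f :
  reflect (f \in qL Q k /\ forall x y, qle Q x y -> f x = f y -> qsim Q x y)
          (f \in qLstr Q k).
Proof.
rewrite [X in reflect _ X]in_set.
apply: (iffP andP) => -[fL h]; split=> //.
  by move=> x y xy e; move/forallP: h => /(_ x)/forallP/(_ y); rewrite xy e eqxx.
apply/forallP => x; apply/forallP => y; apply/implyP => /andP[xy /eqP].
exact: h.
Qed.

Definition level_rel f : rel A :=
  fun x y => (f x == f y) && (qle P x y || qle P y x).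

Lemma level_sym f : connect_sym (level_rel f).
Proof.
by apply: sym_connect_sym => x y; rewrite /level_rel eq_sym orbC.
Qed.

(** Its classes are the connected components of the fibres of [f]. *)
Definition level_eqv f : eqv A :=
  eqv_of (@connect0 _ (level_rel f)) (level_sym f) (@connect_trans _ (level_rel f)).

Lemma level_eqvE f : eqv_rel (level_eqv f) =2 connect (level_rel f).
Proof. exact: eqv_ofE. Qed.

Lemma level_eqv_const f x y : eqv_rel (level_eqv f) x y -> f x = f y.
Proof.
rewrite level_eqvE => h; apply/eqP; move: x y h.
apply: connect_min => [x|y x z /eqP-> //|x y /andP[]//]; exact: eqxx.
Qed.

Lemma qL_level f : f \in qL P k -> f \in qL (qquot P (level_eqv f)) k.
Proof.
move/qLP=> h; apply/qLP; move=> x y; rewrite qposet_ofE; move: x y.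
apply: (connect_min (s := fun x y => (f x <= f y)%N)) => [x|y x z|x y /orP[/h //|]].
- exact: leqnn.
- exact: leq_trans.
- by move/level_eqv_const ->.
Qed.

(** A monotone map which takes the same value at both ends of a path is
    constant along it. *)
Lemma level_step f x y : f \in qL P k -> qle (qquot P (level_eqv f)) x y ->
  f x = f y -> eqv_rel (level_eqv f) x y.
Proof.
move=> fL xy fxy; have /qLP mono := qL_level fL.
move: (xy); rewrite level_eqvE qposet_ofE.
apply: (@connect_between _ _ id) => //; first by move=> z; exists z.
move=> u v xu uv vy; have uv' := connect1 uv.
case/orP: uv => [uv|]; last by rewrite level_eqvE.
have fuv : (f u <= f v)%N by rewrite mono ?qposet_ofE.
have fxu : (f x <= f u)%N by rewrite mono ?qposet_ofE.
have fvy : (f v <= f x)%N by rewrite fxy mono ?qposet_ofE.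
apply/connect1; rewrite /level_rel uv andbT -val_eqE eqn_leq fuv /=.
exact: leq_trans fvy fxu.
Qed.

Lemma qcompat_level f : f \in qL P k -> qcompat (level_eqv f) P.
Proof.
move=> fL; apply/qcompatP; split=> x y.
  rewrite level_eqvE; apply: connect_sub => {x y} x y xy; apply/connect1.
  by rewrite /zigzag level_eqvE connect1 //; case/andP: xy.
case/andP=> xy yx; apply: level_step => //; have /qLP mono := qL_level fL.
by apply/val_inj/eqP; rewrite /= eqn_leq !mono.
Qed.

(** A monotone map of P/E is constant on the classes of [E], which are
    connected; if it is strict, comparable points with the same value are in
    the same class.  So [E] can be recovered from the map. *)
Lemma mem_qLstr_quot f E : qcompat E P ->
  (f \in qLstr (qquot P E) k) = (f \in qL P k) && (level_eqv f == E).
Proof.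
move=> cE; apply/qLstrP/andP => [[/qLP fL fstr]|[fL /eqP <-]]; last first.
  split=> [|x y xy /(level_step fL xy) h]; first exact: qL_level.
  by rewrite (qcompat_sim (qcompat_level fL)).
have fP : f \in qL P k by apply/qLP => x y xy; apply: fL; apply: le_qquot.
split=> //; apply/eqP/eqvP => x y; rewrite level_eqvE; apply/idP/idP.
  apply: (connect_min (@eqv_refl _ E) (@eqv_trans _ E)) => {x y} x y.
  have step u v : qle P u v -> f u = f v -> eqv_rel E u v.
    by move=> uv fuv; rewrite -(qcompat_sim cE) fstr // le_qquot.
  case/andP=> /eqP fxy /orP[xy|yx]; first exact: step.
  by rewrite eqv_symm step.
case/qcompatP: (cE) => h1 _ /h1; apply: connect_sub => {x y} x y /andP[xy h].
apply/connect1; rewrite /level_rel h andbT -val_eqE eqn_leq.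
by rewrite !fL // eqv_qquot // eqv_symm.
Qed.

Lemma card_qL_quot :
  #|qL P k| = (\sum_(E | qcompat E P) #|qLstr (qquot P E) k|)%N.
Proof.
rewrite -sum1_card (partition_big level_eqv (fun E => qcompat E P)) /=.
  apply: eq_bigr => E cE; rewrite -sum1_card; apply: eq_bigl => f.
  by rewrite mem_qLstr_quot.
by move=> f; apply: qcompat_level.
Qed.

End EhrhartCounting.

Section Ehrhart.
Variable K : fieldType.
Hypothesis charK : [pchar K] =i pred0.

Lemma ehr_str_theta (h : Hqp K) : ehr_str (theta h) = ehr h.
Proof.
move: h; apply: linear_icl_ext => [a u v|a u v|A P]; rewrite ?linearP //.
rewrite thetaE linear_sum /= (ehrE charK).
rewrite (eq_bigr _ (fun E _ => ehr_strE charK (qquot P E))).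
apply: (@interpolates_uniq _ charK (fun k => #|qL P k|)); last exact: ehr_poly_spec.
move=> k k0; rewrite card_qL_quot natr_sum horner_sum.
by apply: eq_bigr => E _; rewrite ehr_str_poly_spec.
Qed.

End Ehrhart.

Theorem proposition39 (K : fieldType) (charK : [pchar K] =i pred0) :
  [/\ hopf_automorphism (@theta K),
      cancel (@theta K) (@theta_inv K) /\ cancel (@theta_inv K) (@theta K),
      forall h : Hqp K, ehr_str (theta h) = ehr h
    & forall h : Hqp K, ehr (theta_inv h) = ehr_str h].
Proof.
have lt : linear (@theta K) by move=> a u v; rewrite linearP.
split.
- split; last by exists (@theta_inv K); [exact: thetaK|exact: theta_invK].
  split; last exact: theta_antipode.
    by split; [|exact: theta1|exact: thetaM].
  by split; [|exact: theta_coprod|exact: theta_counit].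
- by split; [exact: thetaK|exact: theta_invK].
- exact: ehr_str_theta.
- by move=> h; rewrite -(ehr_str_theta charK) theta_invK.
Qed.
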